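(* Let $\mathcal G$ be a core input-output network with homeostasis pattern network $\mathcal P$, structural pattern network $\mathcal P_{\mathcal S}$ and appendage pattern network $\mathcal P_{\mathcal A}$. A backbone node $\widetilde{\mathcal L}_j\in\mathcal P_{\mathcal S}$ induces every appendage component $\widetilde{\mathcal A}$ of $\mathcal P_{\mathcal A}$ whose node $\mathcal V_{min}(\widetilde{\mathcal A})$ is strictly downstream from $\widetilde{\mathcal L}_j$ in $\mathcal P_{\mathcal S}$, but no other nodes of $\mathcal P_{\mathcal A}$.
   Context: NETWORKS. An input-output network $\mathcal G$ is a finite directed graph with two distinct distinguished nodes, the input node $\iota$ and the output node $o$. It is core if every node is downstream from $\iota$ (there is a directed path from $\iota$ to it) and upstream from $o$. INDUCTION. Each node $j$ carries a variable $x_j\in\mathbb R$. An admissible system is $\dot X=f(X,\mathcal I)$ with $f$ smooth, where the real parameter $\mathcal I$ appears only in $f_\iota$, and $f_j$ depends only on $x_j$ and on those $x_\ell$ with an arrow $\ell\to j$. Write $f_{j,\ell}=\partial f_j/\partial x_\ell$; for $j\ne\ell$, $f_{j,\ell}\equiv 0$ precisely when there is no arrow $\ell\to j$. If $X_0$ is a hyperbolic equilibrium at $\mathcal I_0$, there is a unique family of equilibria $X(\mathcal I)$ near $\mathcal I_0$ with $X(\mathcal I_0)=X_0$; a node $\kappa$ is homeostatic at $(X_0,\mathcal I_0)$ if $x_\kappa'(\mathcal I_0)=0$. The homeostasis matrix $H$ is the Jacobian $J=(f_{j,\ell})$ with the row of $\iota$ and the column of $o$ deleted. There are permutation matrices $P,Q$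 such that $PHQ$ is block upper triangular with square diagonal blocks $B_1,\dots,B_m$ that cannot be further block triangularized (entries $f_{j,\ell}$ regarded as independent indeterminates); these are the homeostasis blocks. The homeostasis subnetwork $\mathcal K_\eta$ of $B_\eta$ has as nodes all $p,q$ such that $f_{p,q}$ is a nonzero entry of $B_\eta$, and as arrows the corresponding $q\to p$ with $p\ne q$. $\mathcal K_\eta$ is homeostasis inducing at $(X_0,\mathcal I_0)$ if $\det B_\eta=0$ there. $\mathcal K\Rightarrow\kappa$ ($\mathcal K$ induces node $\kappa$) means: generically for admissible $f$, $\kappa$ is homeostatic whenever $\mathcal K$ is homeostasis inducing. Here ''generically'' means: except when the partial derivatives at $(X_0,\mathcal I_0)$ satisfy an additional polynomial equation not vanishing identically on the set where the determinant of the block of $\mathcal K$ is zero. For a set $\mathcal N$ of nodes (or a subnetwork), $\mathcal K\Rightarrow\mathcal N$ means $\mathcal K\Rightarrow\kappa$ for every $\kappa\in\mathcal N$. SIMPLE NODES. A simple path visits each of its nodes once; $\kappa_1\rightsquigarrow\kappa_2$ denotes a simple path from $\kappa_1$ to $\kappa_2$. An $\iota o$-simple path is a simple path from $\iota$ to $o$. A node is simple if it lies on some $\iota o$-simple path, appendage otherwise, and super-simple if it lies on every $\iota o$-simple path. The super-simple nodes are totally ordered, $\iota=\rho_0\prec\rho_1\prec\dots\prec\rho_{q+1}=o$, by order of appearance on any $\iota o$-simple path. If there are a super-simple $\rho$ and an $\iota o$-simple path $\iota\rightsquigarrow\sigma_1\rightsquigarrow\rho\rightsquigarrow\sigma_2\rightsquigarrow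 o$, then $\sigma_1\prec\rho$, $\rho\prec\sigma_2$, $\sigma_1\prec\sigma_2$. A transitive component is a strongly connected component. For an $\iota o$-simple path $S$, the complementary subnetwork $C_S$ consists of all nodes not in $S$ and all arrows between them. An appendage node $\tau$ is super-appendage if for each $C_S$ containing $\tau$, the transitive component of $\tau$ in $C_S$ consists only of appendage nodes. SUBNETWORKS. For $1\le j\le q+1$: the simple subnetwork $\mathcal L_j''$ consists of the simple nodes $\sigma$ with $\rho_{j-1}\prec\sigma\prec\rho_j$ (possibly none); $T_j$ is the set of appendage, non-super-appendage nodes $\tau$ linked to $\mathcal L_j''$, i.e. such that for some $C_S$ the transitive component of $\tau$ in $C_S$ is the union of $\tau$, (at least one) nodes of $\mathcal L_j''$, and non-super-appendage nodes; the augmented simple subnetwork is $\mathcal L_j'=\mathcal L_j''\cup T_j$; the structural subnetwork is $\mathcal L_j=\{\rho_{j-1}\}\cup\mathcal L_j'\cup\{\rho_j\}$, each with all arrows between its nodes. An appendage subnetwork $\mathcal A$ is a transitive component of the subnetwork of super-appendage nodes. It is known that the homeostasis subnetworks of $\mathcal G$ are the structural and the appendage subnetworks. PATTERN NETWORK. $\mathcal P_{\mathcal S}$ is the chain $\iota=\rho_0\to\widetilde{\mathcal L}_1\to\rho_1\to\dots\to\widetilde{\mathcal L}_{q+1}\to\rho_{q+1}=o$, whose nodes are the super-simple nodes and the backbone nodes $\widetilde{\mathcal L}_j$ (representing $\mathcal L_j'$ as a single node, even if empty). $\mathcal P_{\mathcal A}$ has one node $\widetilde{\mathcal A}$ (appendage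 component) for each appendage subnetwork $\mathcal A$, and an arrow $\widetilde{\mathcal A}_1\to\widetilde{\mathcal A}_2$ between distinct nodes iff $\tau_1\to\tau_2$ in $\mathcal G$ for some $\tau_1\in\mathcal A_1,\tau_2\in\mathcal A_2$. An appendage path is a simple path containing an appendage node, all of whose nodes except perhaps the endpoints are appendage. $\mathcal V_{max}(\widetilde{\mathcal A})$ is the most downstream node $\mathcal V$ of $\mathcal P_{\mathcal S}$ such that there is an appendage path from some $\tau\in\mathcal A$ to some simple node $\sigma\in\mathcal V$; $\mathcal V_{min}(\widetilde{\mathcal A})$ is the most upstream node $\mathcal V$ of $\mathcal P_{\mathcal S}$ such that there is an appendage path from some simple node $\sigma\in\mathcal V$ to some $\tau\in\mathcal A$. The homeostasis pattern network $\mathcal P$ consists of the nodes and arrows of $\mathcal P_{\mathcal S}$ and $\mathcal P_{\mathcal A}$ together with the arrows $\widetilde{\mathcal A}\to\mathcal V_{max}(\widetilde{\mathcal A})$ and $\mathcal V_{min}(\widetilde{\mathcal A})\to\widetilde{\mathcal A}$ for each $\widetilde{\mathcal A}$. ''Strictly downstream'' in $\mathcal P_{\mathcal S}$ means strictly later in the chain. The homeostasis subnetworks corresponding to $\widetilde{\mathcal L}_j$ and $\widetilde{\mathcal A}$ are $\mathcal L_j$ and $\mathcal A$. For non-super-simple nodes $\widetilde{\mathcal V}_1,\widetilde{\mathcal V}_2$ of $\mathcal P$ with corresponding homeostasis subnetworks $\mathcal V_1,\mathcal V_2$, $\widetilde{\mathcal V}_1$ induces $\widetilde{\mathcal V}_2$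 iff $\mathcal V_1\Rightarrow\mathcal V_2$. *)

(* Defs.v *)
From mathcomp Require Import all_boot all_order all_algebra all_fingroup.
From mathcomp Require Import all_classical all_reals all_analysis.
From mathcomp.real_closed Require Import complex.
From mathcomp.multinomials Require mpoly.

Set Implicit Arguments.
Unset Strict Implicit.
Unset Printing Implicit Defensive.

Import Order.TTheory GRing.Theory Num.Theory.
Import numFieldNormedType.Exports.

Local Open Scope classical_set_scope.
Local Open Scope ring_scope.

Record io_network (n : nat) := IONetwork {
  arrow :> rel 'I_n.+1;          (* [arrow l j] is the arrow l -> j *)
  inp : 'I_n.+1;
  out : 'I_n.+1;
  inp_neq_out : inp != out }.

Definition core n (G : io_network n) : Prop :=
  forall v, connect G (inp G) v /\ connect G v (out G).

(* dX/dt = f(X, I): [f j (X, I)] is the component of node j. *)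

Definition vector_field (R : realType) (n : nat) :=
  'I_n.+1 -> 'rV[R]_n.+1 * R -> R.

(* C^oo: every iterated directional derivative is differentiable everywhere. *)
Definition smooth (R : realType) (V : normedModType R) (g : V -> R) : Prop :=
  forall (vs : seq V) (x : V),
    differentiable (foldr (fun v h => fun y => 'D_v h y) g vs) x.

Definition partial_x (R : realType) n (f : vector_field R n) (j l : 'I_n.+1)
    (P : 'rV[R]_n.+1 * R) : R :=
  'D_((delta_mx 0 l : 'rV[R]_n.+1), (0 : R)) (f j) P.

Definition partial_I (R : realType) n (f : vector_field R n) (j : 'I_n.+1)
    (P : 'rV[R]_n.+1 * R) : R :=
  'D_((0 : 'rV[R]_n.+1), (1 : R)) (f j) P.

Record admissible (R : realType) n (G : io_network n) (f : vector_field R n) :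
    Prop := Admissible {
  adm_smooth : forall j, smooth (f j);
  adm_param : forall j (X : 'rV[R]_n.+1) (I I' : R), j != inp G -> 
    f j (X, I) = f j (X, I');
  adm_dep : forall j (X Y : 'rV[R]_n.+1) (I : R),
    (forall l, (l == j) || G l j -> X 0 l = Y 0 l) -> f j (X, I) = f j (Y, I);
  adm_arrow : forall j l, j != l ->
    ((forall P, partial_x f j l P = 0) <-> ~~ G l j) }.

Definition jacobian_x (R : realType) n (f : vector_field R n)
    (P : 'rV[R]_n.+1 * R) : 'M[R]_n.+1 := \matrix_(j, l) partial_x f j l P.

Definition hyperbolic_equilibrium (R : realType) n (f : vector_field R n)
    (X0 : 'rV[R]_n.+1) (I0 : R) : Prop :=
  (forall j, f j (X0, I0) = 0) /\
  (forall z : R[i],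
     eigenvalue (map_mx (real_complex R) (jacobian_x f (X0, I0))) z ->
     complex.Re z != 0).

Definition equilibrium_family (R : realType) n (f : vector_field R n)
    (X0 : 'rV[R]_n.+1) (I0 : R) (X : R -> 'rV[R]_n.+1) : Prop :=
  X I0 = X0 /\
  \forall I \near I0, derivable X I 1 /\ forall j, f j (X I, I) = 0.

(* At a hyperbolic equilibrium the germ at I0 of such an X exists and is unique
   by the implicit function theorem. *)
Definition homeostatic (R : realType) n (f : vector_field R n)
    (X0 : 'rV[R]_n.+1) (I0 : R) (k : 'I_n.+1) : Prop :=
  forall X, equilibrium_family f X0 I0 X -> derive1 (fun I => X I 0 k) I0 = 0.

Definition homeostasis_matrix n (G : io_network n) (K : Type)
    (J : 'M[K]_n.+1) : 'M[K]_n := row' (inp G) (col' (out G) J).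

(* Zero pattern of the Jacobian with independent indeterminates as entries:
   [true] marks an indeterminate, [false] an identically zero entry. *)
Definition jacobian_pattern n (G : io_network n) : 'M[bool]_n.+1 :=
  \matrix_(j, l) ((j == l) || G l j).

Definition block_triangularizable k (B : 'M[bool]_k) : Prop :=
  exists (s t : 'S_k) (m : nat), (0 < m < k)%N /\
    forall a b : 'I_k, (m <= a)%N -> (b < m)%N ->
      ~~ row_perm s (col_perm t B) a b.

(* Diagonal block of M on the index set D, in increasing order. *)
Definition diagonal_block (K : Type) n (D : {set 'I_n}) (M : 'M[K]_n) :
    'M[K]_#|D| := mxsub enum_val enum_val M.

(* Permutations of the rows and columns of H, with a division of 0, ..., n-1
   into m consecutive nonempty intervals; [bf_index a] is the interval of a. *)
Record block_form n := BlockForm {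
  bf_rows : 'S_n;
  bf_cols : 'S_n;
  bf_size : nat;
  bf_index : 'I_n -> 'I_bf_size }.

Definition permuted n (F : block_form n) (K : Type) (H : 'M[K]_n) : 'M[K]_n :=
  row_perm (bf_rows F) (col_perm (bf_cols F) H).

Definition block_interval n (F : block_form n) (eta : 'I_(bf_size F)) :
    {set 'I_n} :=
  [set a | bf_index F a == eta]%SET.

Definition block n (G : io_network n) (F : block_form n)
    (eta : 'I_(bf_size F)) (K : Type) (J : 'M[K]_n.+1) :
    'M[K]_#|block_interval eta| :=
  diagonal_block (block_interval eta) (permuted F (homeostasis_matrix G J)).

Record is_homeostasis_form n (G : io_network n) (F : block_form n) : Prop :=
    IsHomeostasisForm {
  hf_mono : forall a b : 'I_n, (a <= b)%N -> (bf_index F a <= bf_index F b)%N;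
  hf_surj : forall eta, exists a, bf_index F a = eta;
  hf_triangular : forall a b : 'I_n, (bf_index F b < bf_index F a)%N ->
    ~~ permuted F (homeostasis_matrix G (jacobian_pattern G)) a b;
  hf_irreducible : forall eta : 'I_(bf_size F),
    ~ block_triangularizable (block G eta (jacobian_pattern G)) }.

(* Row a of [permuted F (homeostasis_matrix G J)] is the row of J of node
   [lift (inp G) (bf_rows F a)], and similarly for columns. *)
Definition block_nodes n (G : io_network n) (F : block_form n)
    (eta : 'I_(bf_size F)) : set 'I_n.+1 :=
  [set v | exists a b : 'I_n,
     [/\ a \in block_interval eta, b \in block_interval eta,
         permuted F (homeostasis_matrix G (jacobian_pattern G)) a b &
         v = lift (inp G) (bf_rows F a) \/ v = lift (out G) (bf_cols F b)]].

(* Polynomials in the entries of J (the partial derivatives in the node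
   variables) and in c (the derivative of the input component in I). *)
Definition eval_partials (R : realType) n
    (p : mpoly.mpoly (n.+1 * n.+1 + 1) R) (J : 'M[R]_n.+1) (c : R) : R :=
  mpoly.meval (fun i => row_mx (mxvec J) (c%:M : 'M[R]_1) 0 i) p.

Definition respects_pattern (R : realType) n (G : io_network n)
    (J : 'M[R]_n.+1) : Prop :=
  forall j l, ~~ jacobian_pattern G j l -> J j l = 0.

(* The node set N induces the node k; subnetworks are given by their nodes. *)
Definition induces_node (R : realType) n (G : io_network n)
    (N : set 'I_n.+1) (k : 'I_n.+1) : Prop :=
  exists (F : block_form n) (eta : 'I_(bf_size F)),
  [/\ is_homeostasis_form G F,
      block_nodes G eta = N &
      exists p : mpoly.mpoly (n.+1 * n.+1 + 1) R,
        (exists J c, [/\ respects_pattern G J, \det (block G eta J) = 0 &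
                         eval_partials p J c != 0]) /\
        (forall (f : vector_field R n) X0 I0,
           admissible G f ->
           hyperbolic_equilibrium f X0 I0 ->
           \det (block G eta (jacobian_x f (X0, I0))) = 0 ->
           eval_partials p (jacobian_x f (X0, I0))
             (partial_I f (inp G) (X0, I0)) != 0 ->
           homeostatic f X0 I0 k)].

Definition induces (R : realType) n (G : io_network n)
    (N M : set 'I_n.+1) : Prop :=
  forall k, M k -> induces_node R G N k.

(* s is the full list of nodes, both endpoints included. *)
Definition simple_path n (G : io_network n) (x y : 'I_n.+1)
    (s : seq 'I_n.+1) : bool :=
  if s is z :: p then [&& z == x, path G z p, uniq s & last z p == y]
  else false.

Definition io_simple_path n (G : io_network n) (s : seq 'I_n.+1) : bool :=
  simple_path G (inp G) (out G) s.

Definition simple_node n (G : io_network n) (v : 'I_n.+1) : Prop :=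
  exists2 s, io_simple_path G s & v \in s.

Definition appendage n (G : io_network n) (v : 'I_n.+1) : Prop :=
  ~ simple_node G v.

Definition super_simple n (G : io_network n) (v : 'I_n.+1) : Prop :=
  forall s, io_simple_path G s -> v \in s.

Definition super_simple_order n (G : io_network n) q
    (rho : q.+2.-tuple 'I_n.+1) : Prop :=
  [/\ uniq rho,
      forall v, v \in rho <-> super_simple G v &
      forall s, io_simple_path G s -> subseq rho s].

Definition precedes n (G : io_network n) (x y : 'I_n.+1) : Prop :=
  exists s r, [/\ io_simple_path G s, super_simple G r,
                  [&& x \in s, r \in s & y \in s],
                  (index x s <= index r s <= index y s)%N & x != y].

(* Transitive component of v in the subnetwork with node set N. *)
Definition transitive_component n (G : io_network n) (N : pred 'I_n.+1)
    (v : 'I_n.+1) : set 'I_n.+1 :=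
  let E := [rel x y | [&& N x, N y & G x y]] in
  [set w | [/\ N v, N w, connect E v w & connect E w v]].

Definition complementary n (s : seq 'I_n.+1) : pred 'I_n.+1 :=
  [pred v | v \notin s].

Definition super_appendage n (G : io_network n) (v : 'I_n.+1) : Prop :=
  appendage G v /\
  forall s, io_simple_path G s -> complementary s v ->
    transitive_component G (complementary s) v `<=` appendage G.

Definition appendage_subnetwork n (G : io_network n) (A : set 'I_n.+1) : Prop :=
  exists2 v, super_appendage G v &
    A = transitive_component G (fun w => `[< super_appendage G w >]) v.

(* The index j : 'I_q.+1 starts at 0 and designates the subnetwork between
   rho_j and rho_(j+1). *)

Definition rho_before n q (rho : q.+2.-tuple 'I_n.+1) (j : 'I_q.+1) :=
  tnth rho (widen_ord (leqnSn q.+1) j).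

Definition rho_after n q (rho : q.+2.-tuple 'I_n.+1) (j : 'I_q.+1) :=
  tnth rho (lift ord0 j).

Definition simple_subnetwork n (G : io_network n) q
    (rho : q.+2.-tuple 'I_n.+1) (j : 'I_q.+1) : set 'I_n.+1 :=
  [set v | [/\ simple_node G v, precedes G (rho_before rho j) v &
               precedes G v (rho_after rho j)]].

Definition linked_appendage n (G : io_network n) q
    (rho : q.+2.-tuple 'I_n.+1) (j : 'I_q.+1) : set 'I_n.+1 :=
  [set t | [/\ appendage G t, ~ super_appendage G t &
     exists s, let C := transitive_component G (complementary s) t in
       [/\ io_simple_path G s, complementary s t,
           exists2 v, C v & simple_subnetwork G rho j v &
           forall v, C v -> [\/ v = t, simple_subnetwork G rho j v |
                                ~ super_appendage G v]]]].

Definition augmented_simple_subnetwork n (G : io_network n) q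
    (rho : q.+2.-tuple 'I_n.+1) (j : 'I_q.+1) : set 'I_n.+1 :=
  simple_subnetwork G rho j `|` linked_appendage G rho j.

Definition structural_subnetwork n (G : io_network n) q
    (rho : q.+2.-tuple 'I_n.+1) (j : 'I_q.+1) : set 'I_n.+1 :=
  [set rho_before rho j] `|` augmented_simple_subnetwork G rho j
    `|` [set rho_after rho j].

(* Nodes of the structural pattern network; [Backbone j] lies between
   [SuperSimple j] and [SuperSimple j+1]. *)
Inductive structural_pattern_node (q : nat) :=
  | SuperSimple of 'I_q.+2
  | Backbone of 'I_q.+1.
Arguments SuperSimple {q}.
Arguments Backbone {q}.

Definition chain_position q (V : structural_pattern_node q) : nat :=
  match V with SuperSimple j => j.*2 | Backbone j => j.*2.+1 end.

Definition strictly_downstream q (V W : structural_pattern_node q) : Prop :=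
  (chain_position W < chain_position V)%N.

Definition pattern_node_members n (G : io_network n) q
    (rho : q.+2.-tuple 'I_n.+1) (V : structural_pattern_node q) :
    set 'I_n.+1 :=
  match V with
  | SuperSimple j => [set tnth rho j]
  | Backbone j => augmented_simple_subnetwork G rho j
  end.

Definition appendage_path n (G : io_network n) (x y : 'I_n.+1)
    (s : seq 'I_n.+1) : Prop :=
  [/\ simple_path G x y s,
      exists2 v, v \in s & appendage G v &
      forall v, v \in s -> v != x -> v != y -> appendage G v].

Definition appendage_path_to n (G : io_network n) q
    (rho : q.+2.-tuple 'I_n.+1) (V : structural_pattern_node q)
    (A : set 'I_n.+1) : Prop :=
  exists x y s, [/\ pattern_node_members G rho V x, simple_node G x, A y &
                    appendage_path G x y s].

Definition is_Vmin n (G : io_network n) q (rho : q.+2.-tuple 'I_n.+1)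
    (A : set 'I_n.+1) (V : structural_pattern_node q) : Prop :=
  appendage_path_to G rho V A /\
  forall W, appendage_path_to G rho W A ->
    (chain_position V <= chain_position W)%N.

(* The homeostasis subnetwork corresponding to [Backbone j] is the structural
   subnetwork, not the augmented simple one that the node represents. *)
Definition backbone_induces (R : realType) n (G : io_network n) q
    (rho : q.+2.-tuple 'I_n.+1) (j : 'I_q.+1) (A : set 'I_n.+1) : Prop :=
  induces R G (structural_subnetwork G rho j) A.

(* Main.v *)
Require Import Defs.
From mathcomp Require Import all_boot all_order all_algebra all_fingroup.
From mathcomp Require Import all_classical all_reals all_analysis.
From mathcomp.real_closed Require Import complex.
From mathcomp.multinomials Require Import (canonicals) mpoly.
From mathcomp Require Import zify ring.

(** Fix the segment between the super-simple nodes [rho_before rho j] and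
[r := rho_after rho j], and let [before G r k] mean that [k] is reachable from
the input along arrows avoiding [r].  Both sides of the theorem say that no node
of the appendage subnetwork is [before G r].

For the right-hand side this is a remark on paths ([Vmin_downstreamP]).  On a
path from the input to an appendage node that avoids [r], the last simple node
starts an appendage path, and it lies in a node of the chain at or before the
backbone node [j]; conversely an appendage path starting at such a simple node
cannot meet [r].

For the left-hand side, implicit differentiation gives [J y = - c e] for the
derivative [y] of the equilibrium, where [e] is the unit vector of the input
([equilibrium_family_derivative]).  A singular block makes the homeostasis
matrix singular, hence [y] vanishes at the output ([singular_block_output]).

If [k] is not [before G r], let [W] be the set of all nodes other than [r] which
are not [before G r].  An arrow into [W] comes from [W] or from [r], so the
equations of the rows in [W] involve only the unknowns in [W] and [r], and the
one at the output is already zero: a square system, whose determinant is a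
polynomial in the entries of [J] that does not vanish identically where the
block is singular.  Where it is nonzero, [y] vanishes on [W] and at [r]
([cut_matrix_zero], [cut_matrix_point], [not_before_induced]).

If [k] is [before G r], every polynomial [p] proposed as a genericity condition
has to be refuted by an admissible system.  A permutation matrix built on a path
from the input to [k] avoiding [r] has a singular block and a nonzero response
at [k]; the identity has a singular block and is hyperbolic; and [p] is nonzero
at some matrix with a singular block.  To meet the three conditions at once one
needs that the matrices with a singular block form an irreducible variety.  The
block cannot be triangularized, so every singular matrix can be deformed into
one with a kernel vector without zero entries ([full_support_dense], by Hall's
condition), and any two of the latter are joined by a polynomial curve of such
matrices ([full_support_connected]).  A quadratic vector field then realizes the
resulting matrix, with an equilibrium moving along a straight line
([before_not_induced]).

Both directions need to know where the structural subnetwork sits in a block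
triangular form.  An input-output path [S] gives a perfect matching of the rows
and columns of the homeostasis matrix (each node of [S] with its successor, all
other nodes with themselves), and the blocks are the strongly connected
components of the walks alternating with respect to any perfect matching.  The
nodes of the component of [rho_before rho j] form the structural subnetwork
([structural_subnetwork_block]); the delicate point is that an appendage node in
it is not super-appendage, which is seen by exchanging the matching along an
alternating cycle ([appendage_in_block_component]).  The nodes [before G r]
index a set of columns which meets exactly as many rows, hence it cannot split a
block ([block_cut]), and this puts [r] among the rows but not the columns of the
block ([after_row_not_col]). *)
Set Implicit Arguments.
Unset Strict Implicit.
Unset Printing Implicit Defensive.

Import Order.TTheory GRing.Theory Num.Theory.
Import numFieldNormedType.Exports.

(** * Matchings of the homeostasis matrix and input-output paths *)

Section Matchings.
Variables (n : nat) (G : io_network n).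
Local Notation node := 'I_n.+1.
Implicit Types (s : {perm node}) (p : seq node) (q r v : node).

(** Row [p] and column [q] of the Jacobian meet in an indeterminate; the diagonal
is included because each node depends on its own variable. *)
Definition feeds (q p : node) : bool := (p == q) || G q p.

(** A perfect matching of the homeostasis matrix as a permutation of all nodes:
column [q] is matched with row [s q], and the deleted column of the output is
sent to the deleted row of the input.  In this way the cycle of [s] through the
input is an input-output path, closed up by the pair of deleted lines. *)
Definition matching s : bool :=
  (s (out G) == inp G) && [forall q, (q != out G) ==> feeds q (s q)].

(** Alternating walks between columns, seen as walks in a digraph; the blocks of the
homeostasis matrix are its strong components. *)
Definition alternation s : rel node :=
  [rel q q' | [&& q != out G, q' != out G & feeds q (s q')]].

Lemma matching_out s : matching s -> s (out G) = inp G.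
Proof. by case/andP => /eqP. Qed.

Lemma matching_feeds s q : matching s -> q != out G -> feeds q (s q).
Proof. by case/andP => _ /forallP /(_ q) /implyP. Qed.

Lemma matching_neq_inp s q : matching s -> (s q == inp G) = (q == out G).
Proof. by move=> ms; rewrite -(matching_out ms) (inj_eq perm_inj). Qed.

(** The permutation [s^-1 s'] moves every column along the alternation of [s], and
its orbits are cyclic; so a step of the alternation of [s'] can be corrected by
running around such an orbit. *)
Lemma alternation_sub s s' : matching s -> matching s' ->
  subrel (connect (alternation s')) (connect (alternation s)).
Proof.
move=> ms ms'; apply: connect_sub => q q' /and3P [qo q'o fq].
pose f x := (s^-1)%g (s' x).
have fo : f (out G) = out G.
  by rewrite /f (matching_out ms') -(matching_out ms) permK.
have finj : injective f by move=> x y /perm_inj /perm_inj.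
have sub : subrel (fconnect f) (connect (alternation s)).
  apply: connect_sub => x _ /eqP <-.
  have [->|xo] := eqVneq x (out G); first by rewrite fo connect0.
  apply: connect1; apply/and3P; rewrite xo /f permKV (matching_feeds ms') //.
  split=> //.
  by apply: contraNneq xo => fx; apply/eqP/finj; rewrite fo.
have q1 : connect (alternation s) (f q') q'.
  by apply: sub; rewrite fconnect_sym //; apply: fconnect1.
apply: connect_trans q1; apply: connect1.
apply/and3P; rewrite qo /f permKV fq; split=> //.
by apply: contraNneq q'o => fx; apply/eqP/finj; rewrite fo.
Qed.

Lemma alternation_indep s s' : matching s -> matching s' ->
  connect (alternation s) =2 connect (alternation s').
Proof.
by move=> ms ms' x y; apply/idP/idP; apply: alternation_sub.
Qed.

Lemma next_last (T : eqType) (x : T) (p : seq T) : uniq (x :: p) ->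
  next (x :: p) (last x p) = x.
Proof.
by move=> u; rewrite next_nth mem_last index_last // nth_default.
Qed.

(** A cycle of the alternation gives a new matching, in which every column of the
cycle takes the row of the next one. *)
Lemma rotate_matching s x q : matching s -> alternation s x q ->
  connect (alternation s) q x -> exists2 s', matching s' & s' x = s q.
Proof.
move=> ms xq /connectP [p0 pth lst].
move: lst xq; case: (shortenP pth) => p pp up _ -> xq.
set c := q :: p in up *.
have cc : path.cycle (alternation s) c.
  by rewrite /c /= rcons_path pp.
have ninj : injective (next c).
  by apply: can_inj (prev c) _; apply: prev_next.
have co : out G \notin c.
  by apply/negP => /(next_cycle cc) /and3P [/eqP].
exists (perm ninj * s)%g; last first.
  by rewrite permM permE /c next_last.
apply/andP; split.
  rewrite permM permE next_nth (negPf co); apply/eqP; exact: matching_out.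
apply/forallP => z; apply/implyP => zo; rewrite permM permE.
have [zc|zc] := boolP (z \in c).
  by have /and3P [] := next_cycle cc zc.
by rewrite next_nth (negPf zc) matching_feeds.
Qed.

Lemma simple_pathP x y p : reflect
  (exists p', [/\ p = x :: p', path G x p', uniq (x :: p') & last x p' = y])
  (simple_path G x y p).
Proof.
case: p => [|z p]; first by constructor; case=> p' [].
apply: (iffP and4P) => [[/eqP -> pp up /eqP l]|[p' [[-> ->] pp up l]]].
  by exists p.
by split => //; apply/eqP.
Qed.

Lemma io_path_inp p : io_simple_path G p -> inp G \in p.
Proof. by case/simple_pathP => p' [-> _ _ _]; rewrite mem_head. Qed.

Lemma io_path_out p : io_simple_path G p -> out G \in p.
Proof. by case/simple_pathP => p' [-> _ _ <-]; rewrite mem_last. Qed.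

Lemma io_path_uniq p : io_simple_path G p -> uniq p.
Proof. by case/simple_pathP => p' [-> _]. Qed.

Lemma io_path_out_index p : io_simple_path G p -> (index (out G) p).+1 = size p.
Proof. by case/simple_pathP => p' [-> _ up <-]; rewrite index_last. Qed.

Lemma path_next x y p v : simple_path G x y p -> v \in p -> v != y ->
  G v (next p v).
Proof.
case/simple_pathP => p' [-> pp up lp] vp vy.
have cc : path.cycle [rel a b | G a b || (a == y)] (x :: p').
  rewrite /= rcons_path lp /= eqxx orbT andbT.
  by apply: sub_path pp => a b /= ->.
by have := next_cycle cc vp; rewrite /= (negPf vy) orbF.
Qed.

Lemma path_perm x y p : simple_path G x y p ->
  exists2 s : {perm node}, s =1 next p & s y = x.
Proof.
case/simple_pathP => p' [-> pp up lp].
have ninj : injective (next (x :: p')).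
  by apply: can_inj (prev (x :: p')) _; apply: prev_next.
by exists (perm ninj) => [z|]; rewrite permE // -lp next_last.
Qed.

(** The successor function of the path, closed up, with all other nodes fixed. *)
Lemma path_matching p : io_simple_path G p ->
  exists2 s, matching s & s =1 next p.
Proof.
move=> ip; have [s sE so] := path_perm ip; exists s => //.
apply/andP; split; first exact/eqP.
apply/forallP => z; apply/implyP => zo; rewrite sE /feeds.
have [zp|zp] := boolP (z \in p); first by rewrite (path_next ip) ?orbT.
by rewrite next_nth (negPf zp) eqxx.
Qed.

Lemma next_notin (T : eqType) (p : seq T) (v : T) : v \notin p -> next p v = v.
Proof. by rewrite next_nth => /negPf ->. Qed.

(** The orbit of the input returns to it through the output, and each of its steps
except that last one is an arrow. *)
Lemma matching_path s : matching s ->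
  exists2 p, io_simple_path G p & forall v, (v \in p) = fconnect s (inp G) v.
Proof.
move=> ms; exists (fingraph.orbit s (inp G)) => [|v]; last by rewrite -fconnect_orbit.
set N := fingraph.order s (inp G).
have N0 : (0 < N)%N by apply: fingraph.order_gt0.
have oE : fingraph.orbit s (inp G) = inp G :: traject s (s (inp G)) N.-1.
  by rewrite /fingraph.orbit -/N -(prednK N0).
have lE : last (inp G) (traject s (s (inp G)) N.-1) = out G.
  rewrite last_traject -/(finv s (inp G)) -(matching_out ms).
  exact: (finv_f perm_inj).

have up := orbit_uniq s (inp G).
apply/simple_pathP; exists (traject s (s (inp G)) N.-1).
rewrite -oE; split=> //.
move: up; rewrite oE.
move: lE (fpath_traject s (inp G) N.-1).
move: (traject _ _ _) => p; elim: p (inp G) => //= a p IH x lE /andP [/eqP sx pp].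
rewrite inE negb_or => /and3P [/andP [xa xp] ap up].
apply/andP; split; last by apply: IH => //; rewrite /= ap up.
have xo : x != out G.
  rewrite -lE; have := mem_last a p; rewrite inE => /orP [/eqP -> //|lp].
  by apply: contraNneq xp => ->.
have := matching_feeds ms xo; rewrite sx /feeds eq_sym.
by rewrite eq_sym [a == x]eq_sym (negPf xa).
Qed.

End Matchings.

(** * Cutting the network at a super-simple node *)

Section Cuts.
Variables (n : nat) (G : io_network n).
Local Notation node := 'I_n.+1.
Implicit Types (s : {perm node}) (p : seq node) (q r v u x y : node).

Definition avoiding r : rel node := [rel x y | [&& x != r, y != r & G x y]].

Definition before r v : bool :=
  [&& inp G != r, v != r & connect (avoiding r) (inp G) v].

Lemma path_avoiding r x p : x != r -> r \notin p -> path G x p ->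
  path (avoiding r) x p.
Proof.
elim: p x => //= y p IH x xr; rewrite inE negb_or => /andP [ry rp] /andP [xy yp].
have yr : y != r by rewrite eq_sym.
by apply/andP; split; [exact/and3P|exact: IH].
Qed.

Lemma avoiding_path r x p : x != r -> path (avoiding r) x p ->
  path G x p /\ r \notin x :: p.
Proof.
elim: p x => [|y p IH] x xr /=; first by rewrite inE eq_sym xr.
case/andP => /and3P [_ yr xy] /(IH _ yr) [-> rp].
by rewrite xy inE negb_or rp eq_sym xr.
Qed.

Lemma avoiding_simple_path r x y : x != r -> connect (avoiding r) x y ->
  exists2 p, simple_path G x y p & r \notin p.
Proof.
move=> xr /connectP [p0 pp ->]; case: (shortenP pp) => p pp' up _.
have [pG rp] := avoiding_path xr pp'.
by exists (x :: p) => //; apply/simple_pathP; exists p.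
Qed.

Lemma before_inp r : inp G != r -> before r (inp G).
Proof. by move=> ir; rewrite /before ir connect0. Qed.

Lemma before_step r u v : before r u -> feeds G u v -> v != r -> before r v.
Proof.
move=> bu; have /and3P [ir ur cu] := bu.
case/orP => [/eqP -> //|uv] vr; rewrite /before ir vr (connect_trans cu) //.
by apply: connect1; apply/and3P.
Qed.

Lemma before_connect r u v : before r u -> connect (avoiding r) u v -> before r v.
Proof.
move=> /and3P [ir ur cu] uv; rewrite /before ir (connect_trans cu uv) andbT.
have [p sp rp] := avoiding_simple_path ur uv.
case/simple_pathP: sp rp => p' [-> _ _ <-] rp.
by apply: contraNneq rp => <-; rewrite mem_last.
Qed.

Lemma super_simple_before_out r : super_simple G r -> ~~ before r (out G).
Proof.
move=> ssr; apply/negP => /and3P [ir _ co].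
have [p ip] := avoiding_simple_path ir co.
by rewrite (ssr p ip).
Qed.

Lemma before_prefix p r v : io_simple_path G p -> v \in p ->
  (index v p < index r p)%N -> before r v.
Proof.
case/simple_pathP => p' [-> pp up lp] vp.
have [->|vi] := eqVneq v (inp G).
  rewrite /= eqxx; case: eqVneq => // ir _; exact: before_inp.
move: vp; rewrite inE (negPf vi) /= => vp'.
rewrite eq_sym (negPf vi) /before; case: eqVneq => // ir.
rewrite ltnS => lt.
have vr : v != r by apply: contraTneq lt => ->; rewrite ltnn.
rewrite vr /=; case/splitPr: vp' lt pp up => p1 p2.
rewrite cat_path cons_uniq cat_uniq mem_cat negb_or.
case/boolP: (r \in p1) => [rp1|rp1] lt /andP [pp1 /= /andP [lv _]]
  /and3P [_ up1 /andP [hp1 _]].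
  have vp1 : v \notin p1 by apply: contraNN hp1 => ->.
  move: lt; rewrite !index_cat rp1 (negPf vp1) /= eqxx addn0.
  by rewrite ltnNge index_size.
apply/connectP; exists (rcons p1 v); last by rewrite last_rcons.
apply: path_avoiding => //; last by rewrite rcons_path pp1.
by rewrite mem_rcons inE negb_or eq_sym vr.
Qed.

Lemma suffix_out p r v : io_simple_path G p -> v \in p ->
  (index r p < index v p)%N -> connect (avoiding r) v (out G).
Proof.
case/simple_pathP => p' [-> pp up lp] vp lt.
have vr : v != r by apply: contraTneq lt => ->; rewrite ltnn.
have vi : v != inp G by apply: contraTneq lt => ->; rewrite /= eqxx.
move: vp; rewrite inE (negPf vi) /= => vp'.
have rp : r \in inp G :: p'.
  rewrite -index_mem (leq_trans lt) // ltnW // index_mem inE vp' orbT //.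
case/splitPr: vp' lt pp up lp rp => p1 p2.
rewrite -cat_cons cat_path cat_uniq !index_cat mem_cat.
move=> lt /andP [_ vpp2] /and3P [_ hp _].
have /andP [_ pp2] := vpp2.
rewrite last_cat /= => lp; case/orP => [rp1|].
  apply/connectP; exists p2 => //; apply: path_avoiding => //.
  by apply: contraNN hp => rp2; apply/hasP; exists r; rewrite // inE rp2 orbT.
move=> rp2; have vp1 : v \notin inp G :: p1.
  by apply: contraNN hp => h; apply/hasP; exists v; rewrite ?mem_head.
have rp1 : r \notin inp G :: p1.
  by apply: contraNN hp => h; apply/hasP; exists r.
by move: lt; rewrite (negPf vp1) (negPf rp1) ltn_add2l /= eqxx.
Qed.

(** A node behind [r] on some path reaches the output without [r]; being reachable
from the input without [r] as well would bypass [r].  Hence the order on any one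
path decides. *)
Lemma before_index p r v : super_simple G r -> io_simple_path G p -> v \in p ->
  before r v = (index v p < index r p)%N.
Proof.
move=> ssr ip vp; apply/idP/idP; last exact: before_prefix.
move=> bv; rewrite ltnNge leq_eqVlt; apply/negP => /orP [/eqP e|lt].
  have rv : r = v by rewrite -(nth_index r (ssr _ ip)) e nth_index.
  by move: bv; rewrite rv /before eqxx andbF.
by have := super_simple_before_out ssr; rewrite (before_connect bv (suffix_out ip vp lt)).
Qed.

(** The columns [before r] meet only rows that are [before r] or equal to [r], the
input excepted.  There are equally many of these rows and columns, so a matching
maps the columns onto the rows. *)
Lemma before_matched s r q : matching G s -> super_simple G r -> r != inp G ->
  q != out G -> before r q = (s q == r) || before r (s q).
Proof.
move=> ms ssr ri qo.
pose A := [set x | before r x]%SET.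
pose B := [set x | (x != inp G) && ((x == r) || before r x)]%SET.
have oA : out G \notin A by rewrite inE super_simple_before_out.
have sub : (s @: A \subset B)%SET.
  apply/fintype.subsetP => _ /imsetP [x xA ->]; rewrite inE.
  have xo : x != out G by apply: contraNneq oA => <-.
  rewrite (matching_neq_inp _ ms) xo /=; case: eqVneq => //= sr.
  by apply: before_step (matching_feeds ms xo) sr; rewrite inE in xA.
have cB : #|B| = #|A|.
  have iA : inp G \in A by rewrite inE before_inp // eq_sym.
  have rA : r \notin A by rewrite inE /before eqxx andbF.
  have -> : B = (r |: A :\ inp G)%SET.
    apply/setP => x; rewrite !inE; case: (eqVneq x r) => [->|//].
    by rewrite ri.
  have rA' : r \notin (A :\ inp G)%SET by rewrite in_setD1 (negPf rA) andbF.
  by rewrite cardsU1 rA' [#|A|](cardsD1 (inp G)) iA.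
have sAB : (s @: A)%SET = B.
  by apply/eqP; rewrite eqEcard sub cB card_imset ?leqnn //; exact: perm_inj.
have <- : (q \in A) = before r q by rewrite inE.
rewrite -(finset.mem_imset _ _ (@perm_inj _ s)) sAB inE.
by rewrite (matching_neq_inp _ ms) qo.
Qed.

Lemma before_alternation s r q q' : matching G s -> super_simple G r ->
  alternation G s q q' -> before r q -> before r q'.
Proof.
move=> ms ssr /and3P [qo q'o f] bq.
have ri : r != inp G by case/and3P: bq; rewrite eq_sym.
rewrite (before_matched ms ssr ri q'o); case: eqVneq => //= sr.
exact: before_step f sr.
Qed.

Lemma before_reach s r q q' : matching G s -> super_simple G r ->
  connect (alternation G s) q q' -> before r q -> before r q'.
Proof.
move=> ms ssr /connectP [p pp ->]; elim: p q pp => //= x p IH q /andP [qx pp] bq.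
by apply: IH pp _; apply: before_alternation qx bq.
Qed.

End Cuts.

(** * Super-simple nodes and the position of an appendage component *)

Lemma index_subseq (T : eqType) m (t : m.-tuple T) (p : seq T) (i k : 'I_m) :
  uniq p -> subseq t p ->
  (i < k)%N -> (index (tnth t i) p < index (tnth t k) p)%N.
Proof.
move=> up tp ik; have x0 : T by exact: (tnth t i).
have pw : pairwise (fun x y => index x p < index y p)%N p.
  apply/(pairwiseP x0) => a b; rewrite !inE => ap bp ab.
  by rewrite !index_uniq.
have /(pairwiseP x0) := subseq_pairwise tp pw.
move/(_ i k); rewrite !inE size_tuple !ltn_ord => /(_ isT isT ik).
by rewrite -!tnth_nth.
Qed.

Section SuperSimple.
Variables (n : nat) (G : io_network n).
Hypothesis hcore : core G.
Variables (q : nat) (rho : q.+2.-tuple 'I_n.+1).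
Hypothesis hrho : super_simple_order G rho.
Local Notation node := 'I_n.+1.
Implicit Types (p : seq node) (r v x y : node) (A : set node).

Lemma connect_simple_path x y : connect G x y -> exists p, simple_path G x y p.
Proof.
case/connectP => p0 pp0 ->; case: (shortenP pp0) => p pp up _.
by exists (x :: p); apply/simple_pathP; exists p.
Qed.

Lemma io_path_exists : exists p, io_simple_path G p.
Proof. by apply: connect_simple_path; case: (hcore (out G)). Qed.

Lemma rho_super i : super_simple G (tnth rho i).
Proof. by case: hrho => _ h _; apply/h/mem_tnth. Qed.

Lemma rho_simple i : simple_node G (tnth rho i).
Proof. by case: io_path_exists => p ip; exists p => //; apply: rho_super. Qed.

Lemma rho_mono p i k : io_simple_path G p ->
  (index (tnth rho i) p < index (tnth rho k) p)%N = (i < k)%N.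
Proof.
move=> ip; have h a b := @index_subseq _ _ rho p a b (io_path_uniq ip).
have sp : subseq rho p by case: hrho => _ _; apply.
apply/idP/idP => [|ik]; last exact: h.
case: (ltngtP i k) => // [ki lt|/ord_inj ->]; last by rewrite ltnn.
by have := h k i sp ki; rewrite ltnNge (ltnW lt).
Qed.

Lemma rho_covers v : super_simple G v -> exists i, v = tnth rho i.
Proof. by case: hrho => _ h _ /h /tnthP. Qed.

Lemma rho_first : tnth rho ord0 = inp G.
Proof.
have [i iE] : exists i, inp G = tnth rho i.
  by apply: rho_covers => p; apply: io_path_inp.
have [p ip] := io_path_exists.
have ii : index (inp G) p = 0%N.
  by case/simple_pathP: ip => p' [-> _ _ _]; rewrite /= eqxx.
case: (posnP i) => [i0|i0].
  by rewrite iE; congr tnth; apply/val_inj.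
by have := rho_mono ord0 i ip; rewrite i0 -iE ii ltn0.
Qed.

Lemma rho_last : tnth rho ord_max = out G.
Proof.
have [i iE] : exists i, out G = tnth rho i.
  by apply: rho_covers => p; apply: io_path_out.
have [p ip] := io_path_exists.
have oi := io_path_out_index ip.
case: (eqVneq i ord_max) => [<- //|im].
have := rho_mono i ord_max ip.
have -> : (i < @ord_max q.+1)%N.
  by move: im; rewrite -val_eqE /= => im; have := ltn_ord i; lia.
have : (index (tnth rho ord_max) p < size p)%N by rewrite index_mem; apply: rho_super.
by rewrite -iE -oi ltnS => h1 h2; move: h1; rewrite leqNgt h2.
Qed.

Lemma rho_after_neq_inp (j : 'I_q.+1) : rho_after rho j != inp G.
Proof.
have [p ip] := io_path_exists; rewrite -rho_first.
have := rho_mono ord0 (lift ord0 j) ip.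
by apply: contraTneq; rewrite /rho_after => ->; rewrite ltnn.
Qed.

Lemma rho_before_index (j : 'I_q.+1) p : io_simple_path G p ->
  (index (rho_before rho j) p < index (rho_after rho j) p)%N.
Proof. by move=> ip; rewrite rho_mono. Qed.

Lemma rho_before_before (j : 'I_q.+1) : before G (rho_after rho j) (rho_before rho j).
Proof.
have [p ip] := io_path_exists; apply: before_prefix (rho_before_index j ip) => //.
exact: rho_super.
Qed.

Lemma rho_before_neq_out (j : 'I_q.+1) : rho_before rho j != out G.
Proof.
apply: contraTneq (rho_before_before j) => ->.
exact: super_simple_before_out (rho_super _).
Qed.

(** On a path through [v], take the last super-simple node not behind [v]: either
it is [v], or [v] belongs to the segment that starts there. *)
Lemma simple_node_pattern v : simple_node G v -> exists2 V,
  pattern_node_members G rho V v &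
  forall j : 'I_q.+1, before G (rho_after rho j) v ->
    (chain_position V <= chain_position (Backbone j))%N.
Proof.
case=> p ip vp.
pose P (i : 'I_q.+2) := (index (tnth rho i) p <= index v p)%N.
have P0 : P ord0.
  rewrite /P rho_first; case/simple_pathP: ip => p' [-> _ _ _].
  by rewrite /= eqxx.
case: (@arg_maxnP _ ord0 P val P0) => i Pi imax.
have bj j : before G (rho_after rho j) v -> (i <= j)%N.
  rewrite (before_index (rho_super _) ip vp) => lt.
  have := leq_ltn_trans Pi lt; rewrite /rho_after rho_mono //.
have [iv|iv] := eqVneq v (tnth rho i).
  by exists (SuperSimple i) => // j /bj; rewrite /= leqNgt => h; rewrite leqNgt; lia.
have ltv : (index (tnth rho i) p < index v p)%N.
  move: Pi; rewrite /P => Pi; rewrite ltn_neqAle Pi andbT; apply: contraNneq iv => e.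
  by rewrite -(nth_index v vp) -e nth_index //; apply: rho_super.
have iq : (i < q.+1)%N.
  have := ltn_ord i; rewrite ltnS leq_eqVlt => /orP [/eqP iE|//].
  have : i = ord_max by apply/val_inj.
  move=> im; move: ltv; rewrite im rho_last.
  have : (index v p < size p)%N by rewrite index_mem.
  by rewrite -(io_path_out_index ip) ltnS => h1 h2; move: h1; rewrite leqNgt h2.
pose i' := Ordinal iq.
have bE : rho_before rho i' = tnth rho i by congr tnth; apply/val_inj.
exists (Backbone i'); last by move=> j /bj /= h; lia.
left; split; first by exists p.
- exists p, (rho_before rho i'); split=> //; first exact: rho_super.
  + by rewrite vp andbT rho_super //; apply: rho_super.
  + by rewrite leqnn bE ltnW.
  + by rewrite bE eq_sym.
- have lta : (index v p < index (rho_after rho i') p)%N.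
    rewrite ltnNge; apply/negP => /(imax (lift ord0 i')) h.
    by have : (i < i)%N := h; rewrite ltnn.
  exists p, (rho_after rho i'); split=> //; first exact: rho_super.
  + by rewrite vp rho_super //; apply: rho_super.
  + by rewrite leqnn ltnW.
  + by apply: contraTneq lta => <-; rewrite ltnn.
Qed.

Lemma pattern_before (j : 'I_q.+1) V v : simple_node G v ->
  pattern_node_members G rho V v ->
  (chain_position V <= chain_position (Backbone j))%N ->
  before G (rho_after rho j) v.
Proof.
move=> sv; case: V => [i /= ->|i /= vi].
  move=> lt; have [p ip] := io_path_exists.
  apply: (before_prefix ip); first by apply: rho_super.
  by rewrite /rho_after rho_mono // lift0; lia.
rewrite ltnS leq_double => ij.
case: vi => [[_ _ [p [r [ip _ /and3P [vp _ ap] /andP [h1 h2] ne]]]]|[]]; last by [].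
apply: (before_prefix ip vp).
have : (index v p < index (rho_after rho i) p)%N.
  rewrite ltn_neqAle (leq_trans h1 h2) andbT; apply: contraNneq ne => e.
  by rewrite -(nth_index v vp) e nth_index.
move/leq_trans; apply.
by rewrite leqNgt rho_mono // !lift0 -leqNgt ltnS.
Qed.

(** After the last simple node on a path to [v] only appendage nodes remain. *)
Lemma last_simple_node (E : rel node) v : subrel E G -> appendage G v ->
  connect E (inp G) v -> exists2 x, simple_node G x & connect E (inp G) x /\
    exists s, appendage_path G x v s.
Proof.
move=> EG av /connectP [p pp lv].
pose E' := [rel x y | E x y && `[< appendage G y >]].
have main x : path E x p -> last x p = v -> connect E' x v \/
    exists y, [/\ simple_node G y, connect E x y & connect E' y v].
  elim: p {pp lv} x => [|y p IH] x /=; first by move=> _ ->; left.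
  case/andP => xy pp lv.
  case: (IH y pp lv) => [Eyv|[z [sz yz zv]]]; last first.
    by right; exists z; split=> //; apply: connect_trans (connect1 xy) yz.
  have [sy|ay] := pselect (simple_node G y).
    by right; exists y; split=> //; apply: connect1.
  left; apply: connect_trans Eyv; apply: connect1; apply/andP; split=> //.
  exact/asboolP.
have si : simple_node G (inp G).
  by case: io_path_exists => s ip; exists s => //; apply: io_path_inp.
have [x [sx bx xv]] :
    exists x, [/\ simple_node G x, connect E (inp G) x & connect E' x v].
  case: (main _ pp (esym lv)) => [h|//].
  by exists (inp G).
exists x => //; split=> //.
case/connectP: xv => p0 pp0 vE; move: vE.
case: (shortenP pp0) => p1 pp1 up1 _ vE; exists (x :: p1).
have sub : forall y, y \in p1 -> appendage G y.
  elim: p1 x pp1 {sx bx pp0 up1 vE} => //= z p1 IH x.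
  case/andP => /andP [_ /asboolP az] pz y.
  by rewrite inE => /orP [/eqP -> //|]; apply: IH pz y.
split.
- apply/simple_pathP; exists p1; split=> //.
  by apply: sub_path pp1 => a b /= /andP [/EG].
- by exists v => //; rewrite vE mem_last.
- by move=> y; rewrite inE => /orP [/eqP ->|yp _ _]; [rewrite eqxx | apply: sub].
Qed.

Lemma avoiding_sub r : subrel (avoiding G r) G.
Proof. by move=> x y /and3P []. Qed.

(** An appendage path ending in an appendage node contains no simple node other than
its starting point, hence not [r]. *)
Lemma appendage_path_before r x v s : simple_node G r -> appendage G v ->
  before G r x -> appendage_path G x v s -> before G r v.
Proof.
move=> sr av bx [/simple_pathP [p [-> pp up lp]] _ ha].
apply: (before_connect bx); apply/connectP; exists p => //.
have xr : x != r by case/and3P: bx.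
apply: path_avoiding => //; apply/negP => rp.
have : appendage G r.
  have [->//|rv] := eqVneq r v.
  by apply: ha => //; rewrite ?inE ?rp ?orbT // eq_sym.
by apply.
Qed.

Lemma appendage_subnetwork_appendage A v : appendage_subnetwork G A -> A v ->
  super_appendage G v.
Proof. by case=> w _ -> [_ /asboolP]. Qed.

(** The node Vmin exists because the network is core: a path from the input to an
appendage node passes a last simple node.  So the statement amounts to the absence
of appendage paths from simple nodes lying before the end of the segment. *)
Lemma Vmin_downstreamP (j : 'I_q.+1) A : appendage_subnetwork G A ->
  (exists2 V, is_Vmin G rho A V & strictly_downstream V (Backbone j)) <->
  (forall v, A v -> ~~ before G (rho_after rho j) v).
Proof.
move=> hA; have aA v : A v -> appendage G v.
  by move=> /(appendage_subnetwork_appendage hA) [].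
split=> [[V [_ Vmin] down] v Av|nb].
  apply/negP => bv.
  have [ir _ cv] := and3P bv.
  have [x sx [ix [s xs]]] := last_simple_node (@avoiding_sub _) (aA _ Av) cv.
  have bx : before G (rho_after rho j) x.
    by apply: before_connect ix; apply: before_inp.
  have [W Wx Wj] := simple_node_pattern sx.
  have : (chain_position V <= chain_position W)%N by apply: Vmin; exists x, v, s.
  by move: (Wj _ bx) down; rewrite /strictly_downstream => h1 h2 h3; lia.
have up W : appendage_path_to G rho W A -> strictly_downstream W (Backbone j).
  case=> x [y [s [Wx sx Ay xy]]]; rewrite /strictly_downstream ltnNge.
  apply/negP => /(pattern_before sx Wx) bx.
  move/negP: (nb _ Ay); apply; apply: (appendage_path_before _ (aA _ Ay) bx xy).
  exact: rho_simple.
have [v Av] : exists v, A v.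
  by case: hA => v sv ->; exists v; split=> //; apply/asboolP.
have exW : exists m, `[< exists2 W, appendage_path_to G rho W A & chain_position W = m >].
  have [x sx [_ [s xs]]] := @last_simple_node G v (fun _ _ => id) (aA _ Av) (hcore v).1.
  have [W Wx _] := simple_node_pattern sx.
  exists (chain_position W); apply/asboolP; exists W => //.
  by exists x, v, s.
case: (ex_minnP exW) => m /asboolP [W hW <-] Wmin.
exists W; last exact: up.
by split=> // W' hW'; apply: Wmin; apply/asboolP; exists W'.
Qed.

End SuperSimple.

(** * Structural subnetworks as strong components of the alternation *)

Lemma connect_exit (T : finType) (e : rel T) (P : pred T) a b :
  connect e a b -> P a -> ~~ P b ->
  exists x y, [/\ P x, ~~ P y, e x y & connect e y b].
Proof.
case/connectP => p pp ->; elim: p a pp => [|y p IH] a /=; first by move=> _ ->.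
case/andP => ay pp Pa Pb; have [Py|Py] := boolP (P y); first exact: IH Py Pb.
by exists a, y; split=> //; apply/connectP; exists p.
Qed.

Section SameBlock.
Variables (n : nat) (G : io_network n).
Local Notation node := 'I_n.+1.
Implicit Types (s : {perm node}) (p : seq node) (q r v u x y z : node).

(** By [alternation_indep] this does not depend on the matching. *)
Definition same_block s x y : bool :=
  connect (alternation G s) x y && connect (alternation G s) y x.

Lemma same_block_refl s x : same_block s x x.
Proof. by rewrite /same_block connect0. Qed.

Lemma same_block_sym s x y : same_block s x y = same_block s y x.
Proof. by rewrite /same_block andbC. Qed.

Lemma same_block_trans s y x z :
  same_block s x y -> same_block s y z -> same_block s x z.
Proof.
case/andP => xy yx /andP [yz zy].
by rewrite /same_block (connect_trans xy yz) (connect_trans zy yx).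
Qed.

Lemma same_block_indep s s' x y : matching G s -> matching G s' ->
  same_block s x y = same_block s' x y.
Proof.
by move=> ms ms'; rewrite /same_block !(alternation_indep ms ms').
Qed.

(** The block of a row is the block of its matched column, whatever the matching. *)
Lemma same_row_block s s' x y : matching G s -> matching G s' ->
  x != out G -> s x = s' y -> same_block s x y.
Proof.
move=> ms ms' xo e.
have yo : y != out G.
  by rewrite -(matching_neq_inp y ms') -e (matching_neq_inp x ms).
rewrite /same_block [X in X && _](alternation_indep ms ms').
rewrite !connect1 //; apply/and3P; split; rewrite ?e ?matching_feeds //.
by rewrite -e matching_feeds.
Qed.

Lemma same_block_neq_out s x y : x != out G -> same_block s x y -> y != out G.
Proof.
move=> xo /andP [/connectP [p pp ->] _].
by elim: p x xo pp => //= z p IH x xo /andP [/and3P [_ zo _]]; apply: IH.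
Qed.

Definition outside p : rel node :=
  [rel x y | [&& complementary p x, complementary p y & G x y]].

(** For the matching of a path, the alternation extends the arrows of its
complementary subnetwork. *)
Lemma outside_alternation s p : io_simple_path G p -> s =1 next p ->
  subrel (connect (outside p)) (connect (alternation G s)).
Proof.
move=> ip sE; apply: connect_sub => x y /and3P [xp yp xy]; apply: connect1.
have op := io_path_out ip.
apply/and3P; split; [by apply: contraNneq xp => ->|by apply: contraNneq yp => ->|].
by rewrite sE next_notin // /feeds xy orbT.
Qed.

Lemma component_same_block s p v w : matching G s -> io_simple_path G p ->
  transitive_component G (complementary p) v w -> same_block s v w.
Proof.
move=> ms ip [_ _ vw wv]; have [s' ms' sE] := path_matching ip.
by rewrite (same_block_indep _ _ ms ms') /same_block !(outside_alternation ip sE).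
Qed.

(** A path avoiding [v] gives a matching in which row [v] is matched with column
[v]. *)
Lemma non_super_simple_row s v u : matching G s -> ~ super_simple G v ->
  u != out G -> s u = v -> same_block s u v.
Proof.
move=> ms nsv uo su.
have [p ip vp] : exists2 p, io_simple_path G p & v \notin p.
  apply: contrapT => h; apply: nsv => p ip; apply: contrapT => vp; apply: h.
  by exists p => //; apply/negP.
have [s' ms' sE] := path_matching ip.
by apply: (same_row_block ms ms' uo); rewrite su sE next_notin.
Qed.

Lemma next_nth_succ p x0 i : uniq p -> (i.+1 < size p)%N ->
  next p (nth x0 p i) = nth x0 p i.+1.
Proof.
move=> up ip; rewrite next_nth mem_nth ?(ltnW ip) // index_uniq ?(ltnW ip) //.
by case: p ip {up} => //= y p ip; apply: set_nth_default.
Qed.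

(** A cycle of a matching that avoids the output is a cycle of arrows of the
network. *)
Lemma permutation_cycle_connect s x (N : pred node) : matching G s ->
  (forall z, fconnect s x z -> N z && (z != out G)) ->
  forall a b, fconnect s x a -> fconnect s x b ->
  connect [rel x y | [&& N x, N y & G x y]] a b.
Proof.
move=> ms h a b xa xb.
have ab : fconnect s a b.
  by apply: connect_trans xb; rewrite fconnect_sym //; apply: perm_inj.
rewrite -(iter_findex ab); move: (findex _ _ _) => k.
elim: k => [|k IH] /=; first exact: connect0.
set c := iter k s a in IH *.
have xc : fconnect s x c by apply: connect_trans xa (fconnect_iter _ _ _).
have /andP [Nc co] := h c xc.
have /andP [Nd _] := h (s c) (connect_trans xc (fconnect1 _ _)).
apply: connect_trans IH _.
have /orP [/eqP ->|cd] := matching_feeds ms co; first exact: connect0.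
by apply: connect1; apply/and3P.
Qed.

(** Let [K] be the component of [v] outside [p].  If [K] has no simple node, leave it
along an alternating step [x -> y] towards [r]; as [x] is reachable from [y], some
matching [s'] takes [x] to the row matched with [y].  Let [p'] be the path of [s'].
It avoids [K], because [K] consists of appendage nodes, and the cycle of [x] under
[s'] is disjoint from it.  That cycle contains a node of [p], for otherwise [y]
would belong to [K]; this node is simple and in the component of [v] outside
[p']. *)
Lemma appendage_in_block_component s p r v : matching G s ->
  io_simple_path G p -> r \in p -> appendage G v -> same_block s r v ->
  exists p', io_simple_path G p' /\ exists2 z, simple_node G z &
    transitive_component G (complementary p') v z.
Proof.
move=> ms0 ip rp av; rename s into s0; have [s ms sE] := path_matching ip.
rewrite (same_block_indep _ _ ms0 ms) => /andP [rv vr].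
have app_notin p' x : io_simple_path G p' -> appendage G x -> x \notin p'.
  by move=> ip' ax; apply/negP => xp'; apply: ax; exists p'.
have vp := app_notin _ _ ip av.
have [[z sz vz]|nz] := pselect (exists2 z, simple_node G z &
    transitive_component G (complementary p) v z).
  by exists p; split=> //; exists z.
pose K x := [&& x \notin p, connect (outside p) v x & connect (outside p) x v].
have Kapp x : K x -> appendage G x.
  case/and3P => xp vx xv sx; apply: nz; exists x => //.
have Kv : K v by rewrite /K vp connect0.
have Kr : ~~ K r by rewrite /K rp.
have [x [y [Kx Ky xy yr]]] := connect_exit vr Kv Kr.
have [xp vx xv] := and3P Kx.
have yx : connect (alternation G s) y x.
  apply: connect_trans yr (connect_trans rv _); exact: (outside_alternation ip sE).
have [s' ms' s'x] := rotate_matching ms xy yx.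
have [p' ip' p'E] := matching_path ms'.
exists p'; split=> //.
have xp' := app_notin _ _ ip' (Kapp _ Kx).
have cyc z : fconnect s' x z -> complementary p' z.
  move=> xz; rewrite /complementary /= p'E; apply: contraNN xp' => iz; rewrite p'E.
  by apply: connect_trans iz _; rewrite fconnect_sym //; apply: perm_inj.
have no z : complementary p' z -> z != out G.
  by apply: contraTneq => ->; rewrite /complementary /= negbK; apply: io_path_out.
have comp z : fconnect s' x z -> transitive_component G (complementary p') x z.
  move=> xz; have h := @permutation_cycle_connect s' x (complementary p') ms'.
  split=> //; [exact: cyc|apply: h => //|apply: h => //] => t xt;
  by rewrite cyc // no // cyc.
have Kpath a b : K a -> K b -> connect (outside p) a b -> connect (outside p') a b.
  move=> Ka Kb /connectP [l pl bE]; elim: l a Ka pl bE => [|c l IH] a Ka /=.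
    by move=> _ ->; apply: connect0.
  case/andP => ac pl bE.
  have Kc : K c.
    have [_ va _] := and3P Ka; have [_ _ bv] := and3P Kb.
    have /and3P [_ cp _] := ac; apply/and3P; split=> //.
      exact: connect_trans va (connect1 ac).
    by apply: connect_trans bv; apply/connectP; exists l.
  apply: connect_trans (IH c Kc pl bE); apply: connect1.
  have /and3P [_ _ Gac] := ac.
  by apply/and3P; split=> //; apply: app_notin ip' (Kapp _ _).
(* a simple node on the cycle of [x] under [s'] *)
have [z xz sz] : exists2 z, fconnect s' x z & simple_node G z.
  have [yp|yp] := boolP (y \in p).
    exists (s' x); first exact: fconnect1.
    by exists p => //; rewrite s'x sE mem_next.
  have syy : s' x = y by rewrite s'x sE next_notin.
  have xy' : fconnect s' x y by rewrite -syy fconnect1.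
  apply: contrapT => nsz; case/negP: Ky.
  have cp z : fconnect s' x z -> complementary p z && (z != out G).
    move=> xz; rewrite no ?cyc // andbT; apply/negP => zp; apply: nsz.
    by exists z => //; exists p.
  have h := permutation_cycle_connect ms' cp; apply/and3P; split=> //.
    by apply: connect_trans vx _; apply: h => //; apply: connect0.
  by apply: connect_trans xv; apply: h => //; apply: connect0.
exists z => //; have [_ zp xz' zx'] := comp z xz.
split=> //; first exact: app_notin.
  by apply: connect_trans xz'; apply: Kpath.
by apply: connect_trans zx' _; apply: Kpath.
Qed.

End SameBlock.

Section StructuralBlock.
Variables (n : nat) (G : io_network n).
Hypothesis hcore : core G.
Variables (q : nat) (rho : q.+2.-tuple 'I_n.+1).
Hypothesis hrho : super_simple_order G rho.
Variable j : 'I_q.+1.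
Local Notation r0 := (rho_before rho j).
Local Notation r := (rho_after rho j).
Implicit Types (s : {perm 'I_n.+1}) (p : seq 'I_n.+1) (v : 'I_n.+1).

Let ss0 : super_simple G r0 := rho_super hrho _.
Let ss1 : super_simple G r := rho_super hrho _.

Lemma between_not_super p v : io_simple_path G p ->
  (index r0 p < index v p)%N -> (index v p < index r p)%N -> ~ super_simple G v.
Proof.
move=> ip lt1 lt2 /(rho_covers hrho) [i vE].
move: lt1 lt2; rewrite vE /rho_before /rho_after !(rho_mono hrho) //= /bump /=; lia.
Qed.

(** Along the path, row [v] is matched with the column of the predecessor of [v];
for [v] not super-simple, row [v] and column [v] lie in the same block. *)
Lemma segment_block s p i : matching G s -> s =1 next p -> io_simple_path G p ->
  (index r0 p <= i < index r p)%N -> same_block G s r0 (nth r0 p i).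
Proof.
move=> ms sE ip.
have up := io_path_uniq ip.
have r0p := ss0 ip; have rp := ss1 ip.
elim: i => [|i IH].
  rewrite leqn0 => /andP [/eqP e _].
  by rewrite -[X in nth _ _ X]e nth_index ?same_block_refl.
case/andP; rewrite leq_eqVlt => /orP [/eqP <- _|lt1 lt2].
  by rewrite nth_index ?same_block_refl.
have isz : (i.+1 < size p)%N by apply: leq_trans lt2 _; rewrite ltnW // index_mem.
apply: same_block_trans (IH _) _; first by rewrite -ltnS lt1 ltnW.
apply: non_super_simple_row => //.
- apply: (between_not_super ip); by rewrite index_uniq.
- apply: contraTneq isz => e; rewrite -leqNgt -(io_path_out_index ip) -e.
  by rewrite index_uniq // (leq_trans _ (index_size r p)) // ltnW.
- by rewrite sE next_nth_succ.
Qed.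

(** No alternating walk crosses the cut at [r] or at [r0] forwards, and [r0], which
lies between the two, reaches every column of its block and is reached from it. *)
Lemma block_bounds s v : matching G s -> same_block G s r0 v ->
  before G r v && ~~ before G r0 v.
Proof.
move=> ms /andP [r0v vr0]; apply/andP; split.
  exact: before_reach ms ss1 r0v (rho_before_before hcore hrho j).
apply/negP => /(before_reach ms ss0 vr0).
by rewrite /before eqxx andbF.
Qed.

Lemma simple_in_block s v : matching G s -> simple_node G v ->
  same_block G s r0 v -> v != r0 -> simple_subnetwork G rho j v.
Proof.
move=> ms [p ip vp] /(block_bounds ms) /andP [].
rewrite (before_index ss1 ip vp) (before_index ss0 ip vp) -leqNgt => lt2 le1 ne.
split; first by exists p.
- exists p, r0; split=> //; first by rewrite vp (ss0 ip).
  + by rewrite leqnn le1.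
  + by rewrite eq_sym.
- exists p, r; split=> //; first by rewrite vp (ss1 ip).
  + by rewrite leqnn ltnW.
  + by apply: contraTneq lt2 => <-; rewrite ltnn.
Qed.

Lemma simple_subnetwork_block s v : matching G s ->
  simple_subnetwork G rho j v -> same_block G s r0 v.
Proof.
move=> ms [_ [p [u [ip _ /and3P [_ _ vp] /andP [h1 h2] ne]]]].
case=> p2 [u2 [ip2 _ /and3P [vp2 _ _] /andP [h3 h4] ne2]].
have bv : before G r v.
  rewrite (before_index ss1 ip2 vp2) ltn_neqAle (leq_trans h3 h4) andbT.
  by apply: contraNneq ne2 => e; rewrite -(nth_index v vp2) e nth_index //; apply: ss1.
have [s' ms' sE] := path_matching ip.
rewrite (same_block_indep _ _ ms ms') -(nth_index r0 vp).
apply: (segment_block ms' sE ip).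
by rewrite (leq_trans h1 h2) -(before_index ss1 ip vp).
Qed.

(** The component found by [appendage_in_block_component] contains a simple node, so
none of its nodes is super-appendage. *)
Lemma appendage_in_block s v : matching G s -> appendage G v ->
  same_block G s r0 v -> linked_appendage G rho j v.
Proof.
move=> ms av bv; have [p ip] := io_path_exists hcore.
have [p' [ip' [z sz vz]]] := appendage_in_block_component ms ip (ss0 ip) av bv.
have [vp' zp' v_z z_v] := vz.
have not_super w : transitive_component G (complementary p') v w ->
    ~ super_appendage G w.
  case=> _ wp' vw wv [_ /(_ p' ip' wp' z)]; apply => //.
  by split=> //; [apply: connect_trans wv v_z|apply: connect_trans z_v vw].
split=> //; first by apply: not_super; split=> //; apply: connect0.
exists p'; split=> //; last by move=> w /not_super; constructor 3.
exists z => //; apply: (simple_in_block ms sz).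
  exact: same_block_trans bv (component_same_block ms ip' vz).
by apply: contraNneq zp' => ->; apply: ss0.
Qed.

(** The nodes of the block of column [r0]: its columns, and the rows matched with
them.  The end [r] of the segment is a row only. *)
Lemma structural_subnetwork_block s v : matching G s ->
  structural_subnetwork G rho j v <->
  same_block G s r0 v \/ exists u, [/\ u != out G, same_block G s r0 u & s u = v].
Proof.
move=> ms; have r0o : r0 != out G := rho_before_neq_out hcore hrho j.
split.
- case=> [[->|[sv|[_ _ [p [ip vp [z vz sz] _]]]]]|->].
  + by left; apply: same_block_refl.
  + by left; apply: simple_subnetwork_block.
  + left; apply: (same_block_trans (simple_subnetwork_block ms sz)).
    by rewrite same_block_sym; apply: component_same_block vz.
  + right; have [p ip] := io_path_exists hcore.
    have [s' ms' sE] := path_matching ip.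
    have up := io_path_uniq ip.
    have lt := rho_before_index hrho j ip.
    have rp := ss1 ip.
    pose i := (index r p).-1.
    have iE : i.+1 = index r p by rewrite prednK //; apply: leq_ltn_trans lt.
    have bi : same_block G s' r0 (nth r0 p i).
      by apply: (segment_block ms' sE ip); rewrite -iE leqnn andbT -ltnS iE.
    have io := same_block_neq_out r0o bi.
    have si : s' (nth r0 p i) = r.
      by rewrite sE next_nth_succ ?iE ?nth_index // index_mem.
    exists ((s^-1)%g r); have uo : (s^-1)%g r != out G.
      apply: contraNneq (rho_after_neq_inp hcore hrho j) => e.
      by rewrite -(matching_out ms) -e permKV.
    split=> //; last by rewrite permKV.
    rewrite (same_block_indep _ _ ms ms'); apply: same_block_trans bi _.
    by apply: (same_row_block ms' ms io); rewrite si permKV.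
- have col v' : same_block G s r0 v' -> structural_subnetwork G rho j v'.
    move=> bv; have [->|ne] := eqVneq v' r0; first by left; left.
    left; right; have [sv|av] := pselect (simple_node G v').
      by left; apply: simple_in_block bv ne.
    by right; apply: appendage_in_block bv.
  case=> [/col //|[u [uo bu su]]].
  have [ssv|nsv] := pselect (super_simple G v); last first.
    by apply: col; apply: same_block_trans bu (non_super_simple_row ms nsv uo su).
  right=> /=.
  have /andP [b1 b0] := block_bounds ms bu.
  have rv : before G r v || (v == r).
    have := before_matched ms ss1 (rho_after_neq_inp hcore hrho j) uo.
    by rewrite b1 su orbC => <-.
  case/orP: rv => [rv|/eqP //].
  have [p ip] := io_path_exists hcore.
  have vi : v != inp G by rewrite -su (matching_neq_inp u ms).
  have [i vE] := rho_covers hrho ssv.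
  have vp := ssv p ip.
  have lt : (i < j.+1)%N.
    by move: rv; rewrite (before_index ss1 ip vp) vE /rho_after (rho_mono hrho).
  have h : (v == r0) || before G r0 v.
    rewrite (before_index ss0 ip vp) vE /rho_before (rho_mono hrho) //=.
    move: lt; rewrite ltnS leq_eqVlt => /orP [/eqP e|->]; last by rewrite orbT.
    by rewrite (_ : i = widen_ord (leqnSn q.+1) j) ?eqxx //; apply/val_inj.
  have r0i : r0 != inp G.
    by case/orP: h => [/eqP <- //|/and3P [ir0 _ _]]; rewrite eq_sym.
  by move: b0; rewrite (before_matched ms ss0 r0i uo) su h.
Qed.

End StructuralBlock.

(** * Diagonal blocks of the homeostasis matrix *)

Local Open Scope ring_scope.

Lemma perm_of_seq k (e : seq 'I_k) : uniq e -> size e = k ->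
  exists s : 'S_k, forall x0 a, s a = nth x0 e a.
Proof.
move=> ue se.
have inj : injective (fun a => nth a e a).
  move=> a b /eqP; rewrite (set_nth_default b) ?se // nth_uniq ?se //.
  by move/eqP/val_inj.
exists (perm inj) => x0 a; rewrite permE; apply: set_nth_default.
by rewrite se.
Qed.

Lemma perm_initial k (X : {set 'I_k}) :
  exists s : 'S_k, forall a, (s a \in X) = (a < #|X|)%N.
Proof.
have [||s sE] := @perm_of_seq k (enum X ++ enum (~: X)%SET).
- rewrite cat_uniq !enum_uniq andbT /=; apply/hasPn => x.
  by rewrite !mem_enum inE.
- by rewrite size_cat -!cardE cardsC card_ord.
exists s => a; rewrite (sE a) nth_cat -cardE; case: ltnP => lt.
  by rewrite -mem_enum mem_nth // -cardE.
apply/negbTE; rewrite -finset.in_setC -mem_enum mem_nth // -cardE.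
by rewrite ltn_subLR // cardsC card_ord.
Qed.

Lemma subset_of_card (T : finType) (X : {set T}) m : (m <= #|X|)%N ->
  exists2 Y : {set T}, (Y \subset X)%SET & #|Y| = m.
Proof.
move=> mX; exists [set x in take m (enum X)]%SET.
  by apply/fintype.subsetP => x; rewrite inE => /mem_take; rewrite mem_enum.
rewrite cardsE; apply/eqP.
have /card_uniqP -> : uniq (take m (enum X)) by rewrite take_uniq ?enum_uniq.
by rewrite size_take -cardE; case: ltnP => // h; rewrite eqn_leq mX h.
Qed.

Lemma card_enum_val_preim (T : finType) (D Z : {set T}) : (Z \subset D)%SET ->
  #|[set i : 'I_#|D| | enum_val i \in Z]%SET| = #|Z|.
Proof.
move=> ZD; rewrite -(card_imset _ (@enum_val_inj _ (mem D))); apply: eq_card => x.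
apply/imsetP/idP => [[a]|xZ]; first by rewrite inE => aZ ->.
have xD := fintype.subsetP ZD x xZ.
by exists (enum_rank_in xD x); rewrite ?inE enum_rankK_in.
Qed.

(** Otherwise enough rows are confined to the columns [Z], and moving these rows and
columns to the end triangularizes the block. *)
Lemma irreducible_Hall n (D : {set 'I_n}) (M : 'M[bool]_n) (Z : {set 'I_n}) :
  ~ block_triangularizable (diagonal_block D M) ->
  (Z \subset D)%SET -> Z != finset.set0 -> Z != D ->
  (#|[set a in D | [forall b in D :\: Z, ~~ M a b]]%SET| < #|Z|)%N.
Proof.
move=> irr ZD Z0 ZneD; rewrite ltnNge; apply/negP => le.
set Q := [set a in D | _]%SET in le.
have QD : (Q \subset D)%SET by apply/fintype.subsetP => a; rewrite inE => /andP [].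
pose Z' := [set i : 'I_#|D| | enum_val i \in Z]%SET.
pose Q' := [set i : 'I_#|D| | enum_val i \in Q]%SET.
have cZ : #|Z'| = #|Z| by apply: card_enum_val_preim.
have [|Y YQ cY] := @subset_of_card _ Q' #|Z'|.
  by rewrite cZ card_enum_val_preim.
have [s sE] := perm_initial (~: Y)%SET; have [t tE] := perm_initial (~: Z')%SET.
apply: irr; exists s, t, #|(~: Z')%SET|; split.
  have c := cardsC Z'; rewrite card_ord in c.
  have z0 : (0 < #|Z|)%N by rewrite card_gt0.
  have zD : (#|Z| < #|D|)%N by apply: proper_card; rewrite finset.properEneq ZneD.
  by apply/andP; split; lia.
move=> a b la lb; rewrite !mxE.
have sY : s a \in Y.
  rewrite -[Y]finset.setCK finset.in_setC sE -leqNgt.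
  by move: la; rewrite (cardsCs (~: Z')%SET) (cardsCs (~: Y)%SET) !finset.setCK cY.
have /fintype.subsetP /(_ _ sY) := YQ; rewrite !inE => /andP [_ /forallP h].
have := h (enum_val (t b)); rewrite !inE enum_valP andbT => /implyP; apply.
by have := tE b; rewrite lb !inE.
Qed.

Lemma det_diagonal_block0P (K : fieldType) n (D : {set 'I_n}) (M : 'M[K]_n) :
  \det (diagonal_block D M) = 0 <->
  exists2 v : 'I_n -> K, (exists2 b, b \in D & v b != 0) &
    forall a, a \in D -> \sum_(b in D) M a b * v b = 0.
Proof.
split.
- rewrite -det_tr => /eqP /det0P [u u0 uM].
  pose v b := \sum_(i < #|D| | enum_val i == b) u 0 i.
  have vE i : v (enum_val i) = u 0 i.
    rewrite /v (bigD1 i) //= big1 ?addr0 // => i' /andP [/eqP e].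
    by rewrite (enum_val_inj e) eqxx.
  exists v.
    have /existsP [i ui] : [exists i, u 0 i != 0].
      rewrite -negb_forall; apply: contraNN u0 => /forallP h; apply/eqP/rowP => i.
      by rewrite mxE; apply/eqP.
    by exists (enum_val i); rewrite ?vE // enum_valP.
  move=> a aD; have /rowP /(_ (enum_rank_in aD a)) := uM.
  rewrite !mxE => e; rewrite (big_enum_val (fun b => M a b * v b)) -[RHS]e.
  by apply: eq_bigr => i _; rewrite vE !mxE enum_rankK_in // mulrC.
- case=> v [b bD vb] h; apply/eqP; rewrite -det_tr; apply/det0P.
  exists (\row_i v (enum_val i)).
    apply: contraNneq vb => /rowP /(_ (enum_rank_in bD b)).
    by rewrite !mxE enum_rankK_in // => ->.
  apply/rowP => i; rewrite !mxE -[RHS](h (enum_val i)) ?enum_valP //.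
  rewrite (big_enum_val (fun b => M (enum_val i) b * v b)).
  by apply: eq_bigr => k _; rewrite !mxE mulrC.
Qed.

Section BlockForm.
Variables (n : nat) (G : io_network n) (F : block_form n).
Hypothesis hF : is_homeostasis_form G F.
Local Notation node := 'I_n.+1.
Implicit Types (s : {perm node}) (a b : 'I_n) (eta : 'I_(bf_size F)).

Definition row_node a : node := lift (inp G) (bf_rows F a).
Definition col_node b : node := lift (out G) (bf_cols F b).

Lemma permutedE (K : Type) (J : 'M[K]_n.+1) a b :
  permuted F (homeostasis_matrix G J) a b = J (row_node a) (col_node b).
Proof. by rewrite !mxE. Qed.

Lemma jacobian_patternE p q : jacobian_pattern G p q = feeds G q p.
Proof. by rewrite mxE. Qed.

Lemma row_node_inj : injective row_node.
Proof. by move=> a b /lift_inj /perm_inj. Qed.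

Lemma col_node_inj : injective col_node.
Proof. by move=> a b /lift_inj /perm_inj. Qed.

Lemma row_node_neq a : row_node a != inp G.
Proof. by rewrite eq_sym neq_lift. Qed.

Lemma col_node_neq a : col_node a != out G.
Proof. by rewrite eq_sym neq_lift. Qed.

Lemma row_node_surj p : p != inp G -> exists a, row_node a = p.
Proof.
case: (unliftP (inp G) p) => [i ->|->]; last by rewrite eqxx.
by exists ((bf_rows F)^-1 i)%g; rewrite /row_node permKV.
Qed.

Lemma col_node_surj p : p != out G -> exists a, col_node a = p.
Proof.
case: (unliftP (out G) p) => [i ->|->]; last by rewrite eqxx.
by exists ((bf_cols F)^-1 i)%g; rewrite /col_node permKV.
Qed.

(** Triangularity puts each matched row in a block at most that of its column, and
the sum of the block indices over all rows equals the sum over all columns, so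
equality holds throughout. *)
Lemma matched_row_index s : matching G s -> exists m : 'I_n -> 'I_n,
  injective m /\ forall b, row_node (m b) = s (col_node b) /\
                           bf_index F (m b) = bf_index F b.
Proof.
move=> ms.
have ex b : exists a, row_node a == s (col_node b).
  have [|a <-] := @row_node_surj (s (col_node b)); last by exists a.
  by rewrite (matching_neq_inp _ ms) col_node_neq.
pose m b := xchoose (ex b).
have mE b : row_node (m b) = s (col_node b) by apply/eqP; apply: (xchooseP (ex b)).
have minj : injective m.
  by move=> a b e; apply: col_node_inj; apply: (@perm_inj _ s); rewrite -!mE e.
exists m; split=> // b; split=> //.
have le c : (bf_index F (m c) <= bf_index F c)%N.
  rewrite leqNgt; apply/negP => /(hf_triangular hF).
  rewrite permutedE jacobian_patternE mE; apply/negP; rewrite negbK.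
  by apply: matching_feeds => //; apply: col_node_neq.
have [_] := leqif_sum (fun c (_ : true) => leqif_eq (le c)).
rewrite [X in _ == X](reindex_inj minj) eqxx => /esym /forallP /(_ b) /eqP e.
exact/val_inj.
Qed.

Definition block_rows eta : {set node} := [set row_node a | a in block_interval eta]%SET.
Definition block_cols eta : {set node} := [set col_node a | a in block_interval eta]%SET.

Lemma block_matched s eta q : matching G s -> q != out G ->
  (s q \in block_rows eta) = (q \in block_cols eta).
Proof.
move=> ms qo; have [m [minj mE]] := matched_row_index ms.
have [b <-] := col_node_surj qo.
have [e1 e2] := mE b.
rewrite -e1 !finset.mem_imset; try exact: row_node_inj; try exact: col_node_inj.
by rewrite !inE e2.
Qed.

Lemma block_cols_out eta : out G \notin block_cols eta.
Proof.
by apply/negP => /imsetP [b _ e]; move: (col_node_neq b); rewrite -e eqxx.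
Qed.

Lemma block_nodesE eta v : block_nodes G eta v <->
  exists p q, [/\ p \in block_rows eta, q \in block_cols eta, feeds G q p &
                  v = p \/ v = q].
Proof.
split=> [[a [b [ha hb]]]|[_ [_ [/imsetP [a ha ->] /imsetP [b hb ->]]]]].
  rewrite permutedE jacobian_patternE => f vE.
  exists (row_node a), (col_node b); split=> //; exact: imset_f.
move=> f vE; exists a, b; split=> //.
by rewrite permutedE jacobian_patternE.
Qed.

Lemma block_Hall eta (Z : {set node}) : (Z \subset block_cols eta)%SET ->
  Z != finset.set0 -> Z != block_cols eta ->
  (#|[set p in block_rows eta |
      [forall q in block_cols eta :\: Z, ~~ feeds G q p]]%SET| < #|Z|)%N.
Proof.
move=> ZC Z0 ZneC.
pose Z' := [set b | col_node b \in Z]%SET.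
have ZE : Z = (col_node @: Z')%SET.
  apply/setP => q; apply/idP/imsetP => [qZ|[b bZ ->]]; last by rewrite inE in bZ.
  have /imsetP [b _ e] := fintype.subsetP ZC q qZ.
  by exists b => //; rewrite inE -e.
have := irreducible_Hall (Z := Z') (@hf_irreducible _ _ _ hF eta).
have -> : #|Z'| = #|Z| by rewrite -(card_imset _ col_node_inj) -ZE.
move=> h; apply: leq_ltn_trans (h _ _ _).
- rewrite -(card_imset _ row_node_inj); apply: subset_leq_card.
  apply/fintype.subsetP => p; rewrite inE => /andP [/imsetP [a aD ->] /forallP hp].
  apply: imset_f; rewrite inE aD; apply/forallP => b; apply/implyP.
  rewrite !inE => /andP [bZ bD]; rewrite permutedE jacobian_patternE.
  have /implyP := hp (col_node b); apply; rewrite !inE bZ.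
  by apply: imset_f; rewrite inE.
- apply/fintype.subsetP => b; rewrite inE => bZ.
  have /imsetP [b' b'D /col_node_inj ->] := fintype.subsetP ZC _ bZ.
  by [].
- apply: contraNneq Z0 => Z'0; by rewrite ZE Z'0 imset0.
- by apply: contraNneq ZneC => Z'D; rewrite ZE Z'D.
Qed.

(** The columns of the block that are not [before r] have their matched rows confined
to them, by [before_matched]; Hall's condition leaves only the two trivial
cases. *)
Lemma block_cut s eta r : matching G s -> super_simple G r -> r != inp G ->
  forall q q', q \in block_cols eta -> q' \in block_cols eta ->
  before G r q -> before G r q'.
Proof.
move=> ms ssr ri q q' hq hq' bq; apply/negPn/negP => nbq'.
pose Z := [set x in block_cols eta | ~~ before G r x]%SET.
have ZC : (Z \subset block_cols eta)%SET.
  by apply/fintype.subsetP => x; rewrite inE => /andP [].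
have := @block_Hall eta Z ZC; rewrite ltnNge.
have -> : (#|Z| <= #|[set p in block_rows eta |
      [forall q in block_cols eta :\: Z, ~~ feeds G q p]]%SET|)%N.
  rewrite -(card_imset _ (@perm_inj _ s)); apply: subset_leq_card.
  apply/fintype.subsetP => _ /imsetP [x + ->]; rewrite !inE => /andP [xC nx].
  have xo : x != out G by apply: contraNneq (block_cols_out eta) => <-.
  rewrite (block_matched _ ms xo) xC; apply/forallP => y; apply/implyP.
  rewrite !inE => /andP [+ yC]; rewrite yC negbK /= => by_.
  apply: contraNN nx => f; rewrite (before_matched ms ssr ri xo).
  by case: eqVneq => //= sr; apply: before_step f sr.
move=> h; suff : ~~ true by []; apply: h.
- by apply/set0Pn; exists q'; rewrite inE hq' nbq'.
- by apply/eqP => /setP /(_ q); rewrite inE hq bq.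
Qed.

End BlockForm.

(** * A block triangular form with the structural subnetwork as a block *)

Lemma sorting_perm k (key : 'I_k -> nat) :
  exists t : 'S_k, forall a b : 'I_k, (a <= b)%N -> (key (t a) <= key (t b))%N.
Proof.
pose le : rel 'I_k := fun a b => (key a <= key b)%N.
have letr : transitive le by move=> b a c; apply: leq_trans.
have lerefl : reflexive le by move=> a; apply: leqnn.
have letot : total le by move=> a b; apply: leq_total.
have [||t tE] := @perm_of_seq k (sort le (enum 'I_k)).
- by rewrite sort_uniq enum_uniq.
- by rewrite size_sort size_enum_ord.
exists t => a b ab; rewrite (tE a a) (tE a b).
apply: (sorted_leq_nth letr lerefl) ab; last 2 first.
- by rewrite inE size_sort size_enum_ord.
- by rewrite inE size_sort size_enum_ord.
exact: sort_sorted.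
Qed.

Section BlockFormExists.
Local Open Scope nat_scope.
Variables (n : nat) (G : io_network n).
Local Notation node := 'I_n.+1.
Variable s : {perm node}.
Hypothesis ms : matching G s.
Implicit Types (u v x y : node).

(** Columns are sorted by the number of columns that they reach, with a tag for the
set reached: the key decreases along the alternation, and two columns have the
same key exactly when they lie in the same strong component. *)
Let reach x : {set node} := [set y | connect (alternation G s) x y]%SET.
Let key x : nat := #|reach x| * #|{set node}| + enum_rank (reach x).

Let key_same x y : (key x == key y) = same_block G s x y.
Proof.
apply/eqP/andP => [e|[xy yx]]; last first.
  rewrite /key (_ : reach x = reach y) //; apply/setP => z; rewrite !inE.
  by apply/idP/idP; apply: connect_trans.
have /ord_inj/enum_rank_inj rE : enum_rank (reach x) = enum_rank (reach y) :> nat.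
  have := congr1 (modn^~ #|{set node}|) e.
  by rewrite /key !modnMDl !modn_small //; apply: ltn_ord.
have h1 : y \in reach y by rewrite inE.
have h2 : x \in reach x by rewrite inE.
by rewrite -rE inE in h1; rewrite rE inE in h2.
Qed.

Let key_connect x y : connect (alternation G s) x y -> (key y <= key x)%N.
Proof.
move=> xy; have sub : (reach y \subset reach x)%SET.
  by apply/fintype.subsetP => z; rewrite !inE; apply: connect_trans.
have [e|ne] := eqVneq (reach y) (reach x); first by rewrite /key e.
have lt : (#|reach y| < #|reach x|)%N.
  by apply: proper_card; rewrite finset.properEneq ne.
apply: (@leq_trans ((#|reach y|).+1 * #|{set node}|)).
  by rewrite /key mulSn addnC leq_add2r ltnW // ltn_ord.
by apply: leq_trans (leq_addr _ _); rewrite leq_mul2r lt orbT.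
Qed.

(** Sorting the columns by their key, with the matched order on the rows, makes the
strong components of the alternation into consecutive triangular blocks.  A block
triangularization of one of them would give a set of columns closed under the
alternation, contradicting strong connectedness. *)
Lemma block_form_exists : exists2 F, is_homeostasis_form G F &
  forall x, x != out G -> exists eta : 'I_(bf_size F), forall y,
    (y \in block_cols G eta) = (y != out G) && same_block G s x y.
Proof.
have [t tmono] := sorting_perm (fun a : 'I_n => key (lift (out G) a)).
pose col a := lift (out G) (t a).
have colo a : col a != out G by rewrite eq_sym neq_lift.
have col_inj : injective col by move=> a b /lift_inj /perm_inj.
have col_surj x : x != out G -> exists a, x = col a.
  case: (unliftP (out G) x) => [i -> _|->]; last by rewrite eqxx.
  by exists (t^-1 i)%g; rewrite /col permKV.
pose row a := odflt a (unlift (inp G) (s (col a))).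
have rowE a : lift (inp G) (row a) = s (col a).
  rewrite /row; case: unliftP => [i -> //|e].
  by have := colo a; rewrite -(matching_neq_inp _ ms) e eqxx.
have row_inj : injective row.
  move=> a b e; apply/col_inj/(@perm_inj _ s); by rewrite -!rowE e.
pose ks := sort leq (undup [seq key (col a) | a <- enum 'I_n]).
have uks : uniq ks by rewrite sort_uniq undup_uniq.
have sks : sorted leq ks by apply: sort_sorted; apply: leq_total.
have inks a : key (col a) \in ks.
  by rewrite mem_sort mem_undup; apply/map_f/mem_enum.
have ltks a : (index (key (col a)) ks < size ks)%N by rewrite index_mem.
have index_le a b : (key (col a) <= key (col b))%N =
    (index (key (col a)) ks <= index (key (col b)) ks)%N.
  apply/idP/idP => [le|]; last exact: (sorted_leq_index leq_trans leqnn sks).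
  rewrite leqNgt; apply/negP => lt.
  have ge := sorted_leq_index leq_trans leqnn sks _ _ (inks b) (inks a) (ltnW lt).
  have e : key (col a) = key (col b) by apply/eqP; rewrite eqn_leq le ge.
  by move: lt; rewrite e ltnn.
pose F := BlockForm (perm row_inj) t (fun a => Ordinal (ltks a)).
have rnE a : row_node G F a = s (col a) by rewrite /row_node /= permE rowE.
have cnE a : col_node G F a = col a by [].
have tri a b : feeds G (col b) (s (col a)) -> (bf_index F a <= bf_index F b)%N.
  move=> f; rewrite /= -index_le; apply: key_connect; apply: connect1.
  by apply/and3P.
have patE a b : permuted F (homeostasis_matrix G (jacobian_pattern G)) a b =
    feeds G (col b) (s (col a)).
  by rewrite permutedE jacobian_patternE rnE.
have idxE a b : (bf_index F a == bf_index F b) = same_block G s (col a) (col b).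
  by rewrite -key_same -val_eqE /= !eqn_leq !index_le.
exists F.
  split.
  - by move=> a b ab; rewrite /= -index_le; apply: tmono.
  - move=> eta; have := mem_nth 0 (ltn_ord eta).
    rewrite mem_sort mem_undup => /mapP [a _ aE]; exists a.
    by apply/val_inj; rewrite /= -aE index_uniq.
  - by move=> a b lt; rewrite patE; apply: contraL lt => /tri; rewrite -leqNgt.
  - move=> eta; rewrite /block; set D := block_interval eta.
    case=> s' [t' [m [/andP [m0 mk] h]]].
    pose X := [set enum_val (t' b) | b in [set b : 'I_#|D| | b < m]%N]%SET.
    pose Y := [set enum_val (s' b) | b in [set b : 'I_#|D| | b < m]%N]%SET.
    have h' (a b : 'I_#|D|) : (m <= a)%N -> (b < m)%N ->
        ~~ feeds G (col (enum_val (t' b))) (s (col (enum_val (s' a)))).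
      by move=> la lb; rewrite -patE; have := h a b la lb; rewrite !mxE.
    have closed (x a : 'I_n) : x \in X -> a \in D ->
        feeds G (col x) (s (col a)) -> a \in Y.
      case/imsetP => b; rewrite inE => lb -> aD f.
      have aE : a = enum_val (s' (s'^-1 (enum_rank_in aD a)))%g.
        by rewrite permKV enum_rankK_in.
      rewrite aE in f *; apply: imset_f; rewrite inE ltnNge; apply/negP => lm.
      by have := h' _ b lm lb; rewrite f.
    have XY : X = Y.
      apply/eqP; rewrite eqEcard; apply/andP; split.
        apply/fintype.subsetP => x xX; apply: closed (xX) _ _.
          by case/imsetP: xX => b _ ->; apply: enum_valP.
        exact: matching_feeds.
      rewrite !card_imset //; first by move=> a b /enum_val_inj /perm_inj.
      by move=> a b /enum_val_inj /perm_inj.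
    pose a0 := Ordinal (ltn_trans m0 mk); pose a1 := Ordinal mk.
    pose x := enum_val (t' a0); pose w := enum_val (t' a1).
    have xX : x \in X by apply: imset_f; rewrite inE.
    have wX : w \notin X.
      apply/imsetP => -[b]; rewrite inE => bm /enum_val_inj /perm_inj e.
      by move: bm; rewrite -e /= ltnn.
    have DE a : (a \in D) = (bf_index F a == eta) by rewrite inE.
    have xD : x \in D by apply: enum_valP.
    have wD : w \in D by apply: enum_valP.
    have /andP [xw _] : same_block G s (col x) (col w).
      by move: xD wD; rewrite -idxE !DE => /eqP -> /eqP ->.
    (* the columns of earlier blocks and [X] are together closed *)
    pose P z := [exists c, (z == col c) && ((bf_index F c < eta)%N || (c \in X))].
    have Px : P (col x) by apply/existsP; exists x; rewrite eqxx xX orbT.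
    have Pw : ~~ P (col w).
      apply/existsP => -[c /andP [/eqP/col_inj <-]]; rewrite (negPf wX) orbF.
      by move: wD; rewrite DE => /eqP ->; rewrite ltnn.
    have [z [z' [Pz Pz' /and3P [_ z'o f] _]]] := connect_exit xw Px Pw.
    have [c' c'E] := col_surj _ z'o.
    have /existsP [c /andP [/eqP cE hc]] := Pz.
    rewrite cE c'E in f; have le := tri _ _ f.
    case/negP: Pz'; apply/existsP; exists c'; rewrite c'E eqxx /=.
    case/orP: hc => [lt|cX]; first by rewrite (leq_ltn_trans le lt).
    have cD : c \in D by case/imsetP: cX => b _ ->; apply: enum_valP.
    have [c'D|c'D] := boolP (c' \in D); first by rewrite XY (closed c) // orbT.
    move: le; rewrite DE in cD; rewrite (eqP cD) leq_eqVlt val_eqE -DE.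
    by rewrite (negPf c'D) /= => ->.
move=> x xo; have [a aE] := col_surj x xo; exists (bf_index F a) => y.
apply/imsetP/andP => [[b bD ->]|[yo]].
  by rewrite cnE colo aE -idxE; move: bD; rewrite inE eq_sym => ->.
have [b bE] := col_surj y yo; rewrite aE bE -idxE => e.
by exists b; rewrite ?cnE // inE eq_sym.
Qed.

End BlockFormExists.

Section StructuralBlockForm.
Variables (n : nat) (G : io_network n).
Hypothesis hcore : core G.
Variables (q : nat) (rho : q.+2.-tuple 'I_n.+1).
Hypothesis hrho : super_simple_order G rho.
Variable j : 'I_q.+1.
Local Notation r0 := (rho_before rho j).
Local Notation r := (rho_after rho j).

Lemma structural_block_form : exists (F : block_form n) (eta : 'I_(bf_size F)),
  is_homeostasis_form G F /\ block_nodes G eta = structural_subnetwork G rho j.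
Proof.
have [p ip] := io_path_exists hcore; have [s ms _] := path_matching ip.
have [F hF ex] := block_form_exists ms.
have r0o := rho_before_neq_out hcore hrho j.
have [eta etaE] := ex _ r0o; exists F, eta; split=> //.
apply/seteqP; split=> v /=.
- case/(block_nodesE G) => p' [q' [hp hq _ [->|->]]];
  apply/(structural_subnetwork_block hcore hrho _ _ ms).
  + right; exists ((s^-1)%g p').
    have uo : (s^-1)%g p' != out G.
      rewrite -(matching_neq_inp _ ms) permKV.
      by case/imsetP: hp => a _ ->; apply: row_node_neq.
    move: hp; rewrite -{1}[p'](permKV s) (block_matched hF _ ms uo) etaE => /andP [_ b].
    by split=> //; rewrite permKV.
  + by left; move: hq; rewrite etaE => /andP [].
- move=> /(structural_subnetwork_block hcore hrho _ _ ms) h; apply/(block_nodesE G).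
  have [u [uo ub vE]] : exists u, [/\ u != out G, same_block G s r0 u & v = s u \/ v = u].
    case: h => [b|[u [uo b <-]]]; last by exists u; split=> //; left.
    by exists v; split=> //; [apply: same_block_neq_out b|right].
  exists (s u), u; rewrite (block_matched hF _ ms uo) etaE uo ub.
  by split=> //; apply: matching_feeds.
Qed.

(** If [r] indexed a column of the block, then by [block_cut] no column of the block
would be [before r]; but [r0], as a column or through the column matched with its
row, provides one. *)
Lemma after_row_not_col (F : block_form n) (eta : 'I_(bf_size F)) :
  is_homeostasis_form G F -> block_nodes G eta r0 -> block_nodes G eta r ->
  r \in block_rows G eta /\ r \notin block_cols G eta.
Proof.
move=> hF h0 h1; have [p ip] := io_path_exists hcore.
have [s ms _] := path_matching ip.
have ss := rho_super hrho (lift ord0 j).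
have ri := rho_after_neq_inp hcore hrho j.
have rC : r \notin block_cols G eta.
  apply/negP => rC.
  have no x : x \in block_cols G eta -> ~~ before G r x.
    move=> xC; apply/negP => /(block_cut hF ms ss ri xC rC).
    by rewrite /before eqxx andbF.
  have b0 := rho_before_before hcore hrho j.
  case/(block_nodesE G): h0 => p' [q' [hp hq _ [e|e]]]; last first.
    by have := no _ hq; rewrite -e b0.
  have uo : (s^-1)%g p' != out G.
    rewrite -(matching_neq_inp _ ms) permKV.
    by case/imsetP: hp => a _ ->; apply: row_node_neq.
  move: hp; rewrite -{1}[p'](permKV s) (block_matched hF _ ms uo) => /no.
  by rewrite (before_matched ms ss ri uo) permKV -e b0 orbT.
split=> //; case/(block_nodesE G): h1 => p' [q' [hp hq _ [->//|e]]].
by move: rC; rewrite e hq.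
Qed.

End StructuralBlockForm.

(** * Singular blocks and the nodes behind a cut *)

Lemma det0_kernel (K : fieldType) m (M : 'M[K]_m) :
  \det M = 0 <-> exists2 v : 'I_m -> K, (exists b, v b != 0) &
    forall a, \sum_b M a b * v b = 0.
Proof.
rewrite -det_tr; split.
- move=> /eqP /det0P [u u0 uM]; exists (fun b => u 0 b).
    apply/existsP; rewrite -negb_forall; apply: contraNN u0 => /forallP h.
    by apply/eqP/rowP => i; rewrite mxE; apply/eqP.
  move=> a; move/rowP: uM => /(_ a); rewrite !mxE => e; rewrite -[RHS]e.
  by apply: eq_bigr => b _; rewrite !mxE mulrC.
- case=> v [b vb] h; apply/eqP/det0P; exists (\row_i v i).
    by apply: contraNneq vb => /rowP /(_ b); rewrite !mxE => ->.
  apply/rowP => a; rewrite !mxE -[RHS](h a).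
  by apply: eq_bigr => k _; rewrite !mxE mulrC.
Qed.

Section BlockKernel.
Variables (K : fieldType) (n : nat) (G : io_network n) (F : block_form n).
Hypothesis hF : is_homeostasis_form G F.
Local Notation node := 'I_n.+1.
Variable J : 'M[K]_n.+1.
Hypothesis Jpat : forall p q, ~~ feeds G q p -> J p q = 0.
Variable eta : 'I_(bf_size F).

Lemma det_block_zero_row p : p \in block_rows G eta ->
  (forall q, q \in block_cols G eta -> J p q = 0) -> \det (block G eta J) = 0.
Proof.
case/imsetP => a aD -> h; apply/eqP/det0P.
exists (delta_mx 0 (enum_rank_in aD a)).
  apply/eqP => /matrixP /(_ 0 (enum_rank_in aD a)); rewrite !mxE !eqxx /=.
  by move/eqP; rewrite oner_eq0.
rewrite -rowE; apply/rowP => b; rewrite !mxE enum_rankK_in // h //.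
by apply: imset_f; apply: enum_valP.
Qed.

Lemma sum_col_node (w : 'I_n -> K) (f : node -> K) :
  \sum_q f q * (\sum_(b | col_node G F b == q) w b) =
  \sum_b f (col_node G F b) * w b.
Proof.
rewrite [RHS](partition_big (col_node G F) xpredT) //=.
apply: eq_bigr => q _; rewrite mulr_sumr.
by apply: eq_bigr => b /eqP ->.
Qed.

(** Let [M'] keep the blocks up to [eta] and be the identity elsewhere.  A left kernel
vector of the block [eta] is one of [M'], because the rows of that block vanish in
the earlier columns.  A right kernel vector of [M'] is then one of the whole
matrix, because the columns up to [eta] vanish in the later rows. *)
Lemma singular_block_kernel : \det (block G eta J) = 0 ->
  exists v : node -> K, [/\ exists q, v q != 0, v (out G) = 0 &
    forall p, p != inp G -> \sum_q J p q * v q = 0].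
Proof.
have [M defM] : exists M, M = permuted F (homeostasis_matrix G J) by eexists.
have MT a b : (bf_index F b < bf_index F a)%N -> M a b = 0.
  move=> lt; rewrite defM permutedE Jpat //.
  by have := hf_triangular hF lt; rewrite permutedE jacobian_patternE.
rewrite -det_tr.
rewrite (_ : (block G eta J)^T = diagonal_block (block_interval eta) M^T); last first.
  by apply/matrixP => a b; rewrite defM !mxE.
case/det_diagonal_block0P => u [b0 b0D ub0] hu.
pose le a := (bf_index F a <= eta)%N.
have inD a : (a \in block_interval eta) = (bf_index F a == eta) by rewrite inE.
pose M' := \matrix_(a, b) (if le a && le b then M a b else (a == b)%:R).
have : \det M' = 0.
  rewrite -det_tr; apply/det0_kernel.
  exists (fun a => if a \in block_interval eta then u a else 0).
    by exists b0; rewrite b0D.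
  move=> b; under eq_bigr => a _ do rewrite !mxE.
  rewrite (bigID (mem (block_interval eta))) /= [X in _ + X]big1 ?addr0; last first.
    by move=> a /negPf ->; rewrite mulr0.
  have leD a : a \in block_interval eta -> le a.
    by rewrite inD /le => /eqP ->.
  under eq_bigr => a aD do rewrite aD (leD _ aD) /=.
  have [bD|bD] := boolP (b \in block_interval eta).
    rewrite -[RHS](hu b bD); apply: eq_bigr => a aD.
    by rewrite leD // mxE.
  apply: big1 => a aD; case: ifP => lb.
    rewrite MT ?mul0r //; move: aD; rewrite inD => /eqP ->.
    by rewrite ltn_neqAle -/(le b) lb andbT val_eqE -inD.
  by rewrite (_ : (a == b) = false) ?mul0r //; apply: contraNF bD => /eqP <-.
case/det0_kernel => w [b1 wb1] hw.
have w0 b : ~~ le b -> w b = 0.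
  move=> nb; have := hw b; rewrite (bigD1 b) //= big1 ?addr0.
    by rewrite !mxE (negPf nb) /= eqxx mul1r.
  by move=> a ab; rewrite !mxE (negPf nb) eq_sym (negPf ab) mul0r.
pose v q := \sum_(b | col_node G F b == q) w b.
exists v; split.
- exists (col_node G F b1); rewrite /v (bigD1 b1) //= big1 ?addr0 //.
  by move=> b /andP [/eqP/col_node_inj ->]; rewrite eqxx.
- rewrite /v big1 // => b; by rewrite (negPf (col_node_neq _ _ _)).
- move=> p pi; have [a <-] := row_node_surj F pi.
  rewrite sum_col_node.
  have ME b : J (row_node G F a) (col_node G F b) = M a b by rewrite defM permutedE.
  under eq_bigr => b _ do rewrite ME.
  have [la|la] := boolP (le a); last first.
    apply: big1 => b _; have [lb|lb] := boolP (le b); last by rewrite w0 ?mulr0.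
    by rewrite MT ?mul0r // (leq_ltn_trans lb) // ltnNge.
  rewrite -[RHS](hw a); apply: eq_bigr => b _; rewrite mxE la /=.
  by case: ifP => // /negbT lb; rewrite w0 ?mulr0.
Qed.

(** As [J] is invertible, the solutions of the equations of all rows but the input
form a line, and [singular_block_kernel] gives a point of that line which vanishes
at the output. *)
Lemma singular_block_output (y : node -> K) : \det J != 0 ->
  \det (block G eta J) = 0 ->
  (forall p, p != inp G -> \sum_q J p q * y q = 0) -> y (out G) = 0.
Proof.
move=> dJ /singular_block_kernel [v [[q0 vq0] vo hv]] hy.
have Jinj (w : node -> K) : (forall p, \sum_q J p q * w q = 0) -> forall q, w q = 0.
  move=> hw q; apply/eqP; apply: contraNT dJ => wq.
  by apply/eqP/det0_kernel; exists w => //; exists q.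
pose A := \sum_q J (inp G) q * v q; pose B := \sum_q J (inp G) q * y q.
have A0 : A != 0.
  apply: contraNneq vq0 => A0; apply/eqP/Jinj => p.
  by have [->//|] := eqVneq p (inp G); apply: hv.
have hAB p : \sum_q J p q * (A * y q - B * v q) = 0.
  have -> : \sum_q J p q * (A * y q - B * v q) =
      A * (\sum_q J p q * y q) - B * (\sum_q J p q * v q).
    rewrite !mulr_sumr -sumrB; apply: eq_bigr => q _.
    by rewrite mulrBr !mulrA ![J p q * _]mulrC.
  have [->|pi] := eqVneq p (inp G); first by rewrite -/A -/B mulrC subrr.
  by rewrite hy // hv // !mulr0 subrr.
have /eqP := Jinj (fun q => A * y q - B * v q) hAB (out G).
by rewrite vo mulr0 subr0 mulf_eq0 (negPf A0) => /eqP.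
Qed.

End BlockKernel.

Section Separated.
Variables (n : nat) (G : io_network n) (r : 'I_n.+1).
Hypothesis ri : r != inp G.
Local Notation node := 'I_n.+1.

(** The system satisfied by the unknowns behind the cut, completed to a square matrix
by equations which kill the unknowns [before r] and the one at the output. *)
Definition cut_matrix (K : pzRingType) (J : 'M[K]_n.+1) : 'M[K]_n.+1 :=
  \matrix_(a, b) if before G r a then (a == b)%:R
                 else if a == r then (b == out G)%:R else J a b.

(** The rows kept from [J] have no entry in the columns [before r], so setting the
unknowns [before r] to zero preserves a solution. *)
Lemma cut_matrix_zero (K : fieldType) (J : 'M[K]_n.+1) (y : node -> K) :
  (forall p q, ~~ feeds G q p -> J p q = 0) -> super_simple G r ->
  (forall p, p != inp G -> \sum_q J p q * y q = 0) -> y (out G) = 0 ->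
  \det (cut_matrix J) != 0 -> forall k, ~~ before G r k -> y k = 0.
Proof.
move=> Jpat ssr hy yo dM k nk; apply/eqP; apply: contraNT dM => yk.
apply/eqP/det0_kernel; exists (fun b => if before G r b then 0 else y b).
  by exists k; rewrite (negPf nk).
move=> a; under eq_bigr => b _ do rewrite mxE.
have [ba|nba] := boolP (before G r a).
  apply: big1 => b _; case: eqVneq => [<-|_]; last by rewrite mul0r.
  by rewrite ba mulr0.
have [ar|ar] := eqVneq a r.
  apply: big1 => b _; case: eqVneq => [->|_]; last by rewrite mul0r.
  by rewrite yo if_same mulr0.
have ai : a != inp G by apply: contraNneq nba => ->; rewrite before_inp // eq_sym.
rewrite -[RHS](hy a ai); apply: eq_bigr => b _; case: ifP => // bb.
rewrite mulr0 Jpat ?mul0r //; apply: contraNN nba => f.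
exact: before_step bb f ar.
Qed.

(** The matching entries of the kept rows: [before_matched] says that these rows are
matched with the columns that are not [before r], the output excepted. *)
Lemma cut_matrix_point (K : fieldType) (s : {perm node}) :
  matching G s -> super_simple G r ->
  exists J : 'M[K]_n.+1,
    [/\ forall p q, ~~ feeds G q p -> J p q = 0, forall q, J r q = 0 &
        \det (cut_matrix J) != 0].
Proof.
move=> ms ssr.
exists (\matrix_(a, b) (~~ before G r a && (a != r) && (a == s b))%:R); split.
- move=> p q f; rewrite mxE; case: (eqVneq p (s q)) => [e|]; last by rewrite andbF.
  have [qo|qo] := eqVneq q (out G).
    rewrite e qo (matching_out ms) before_inp //; by rewrite eq_sym.
  by case/negP: f; rewrite e matching_feeds.
- by move=> q; rewrite mxE eqxx andbF.
apply/eqP => /det0_kernel [w [b wb] hw]; case/negP: wb; apply/eqP.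
have [bb|nb] := boolP (before G r b).
  have := hw b; rewrite (bigD1 b) //= big1 ?addr0; first by rewrite mxE bb eqxx mul1r.
  by move=> c cb; rewrite mxE bb eq_sym (negPf cb) mul0r.
have [->|bo] := eqVneq b (out G).
  have := hw r; rewrite (bigD1 (out G)) //= big1 ?addr0.
    by rewrite mxE /before eqxx andbF /= eqxx mul1r.
  by move=> c co; rewrite mxE /before eqxx andbF /= (negPf co) mul0r.
have := before_matched ms ssr ri bo; rewrite (negPf nb) => /esym/negbT.
rewrite negb_or => /andP [sr nbs].
have := hw (s b); rewrite (bigD1 b) //= big1 ?addr0.
  by rewrite !mxE (negPf nbs) (negPf sr) /= eqxx mul1r.
move=> c cb; rewrite !mxE (negPf nbs) (negPf sr) /=.
by rewrite (inj_eq perm_inj) eq_sym (negPf cb) mul0r.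
Qed.

End Separated.

Section PartialsPolynomial.
Variables (R : realType) (n : nat).

Definition entry_var (a b : 'I_n.+1) : mpoly.mpoly (n.+1 * n.+1 + 1) R :=
  mpoly.mpolyX R (mpoly.mnm1 (lshift 1 (mxvec_index a b))).

Lemma eval_entry_var a b (J : 'M[R]_n.+1) c :
  eval_partials (entry_var a b) J c = J a b.
Proof.
by rewrite /eval_partials mpoly.mevalXU row_mxEl mxvecE.
Qed.

Lemma eval_det_cut_matrix (G : io_network n) r (J : 'M[R]_n.+1) c :
  eval_partials (\det (cut_matrix G r (\matrix_(a, b) entry_var a b))) J c =
  \det (cut_matrix G r J).
Proof.
rewrite /eval_partials -det_map_mx; congr (\det _).
apply/matrixP => a b; rewrite !mxE.
case: ifP => _; first by rewrite rmorph_nat.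
case: ifP => _; first by rewrite rmorph_nat.
by apply: eval_entry_var.
Qed.

End PartialsPolynomial.

(** * Differentiating equilibria *)

Section LineDerivative.
Local Open Scope classical_set_scope.
Local Open Scope ring_scope.

Lemma derive_quadratic (R : realType) (V : normedModType R) (g : V -> R)
    (x v : V) (a b : R) :
  (forall h, g (h *: v + x) = g x + h * a + h ^+ 2 * b) -> 'D_v g x = a.
Proof.
move=> hg; apply: cvg_lim => //.
apply: (@cvg_trans _ ((fun h : R => a + h * b) @ (0 : R)^')).
  apply: near_eq_cvg; near=> h.
  have h0 : h != 0 by near: h; exact: nbhs_dnbhs_neq.
  rewrite [X in _ *: (X - _)](hg h) -[RHS]/(h^-1 * _).
  by field.
have : (fun h : R => a + h * b) @ (0 : R) --> a + 0 * b.
  apply: cvgD; first exact: cvg_cst.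
  by apply: cvgMl; exact: cvg_id.
rewrite mul0r addr0; apply: cvg_trans; apply: cvg_app; exact: cvg_within.
Unshelve. all: by end_near. Qed.

End LineDerivative.

(** A singular matrix has the eigenvalue zero, which lies on the imaginary axis. *)
Lemma det_neq0_spectrum (R : realType) n (J : 'M[R]_n) :
  (forall z, eigenvalue (map_mx (real_complex R) J) z -> complex.Re z != 0) ->
  \det J != 0.
Proof.
move=> h; apply/eqP => d0.
have /eqP/det0P [v v0 vJ] : \det (map_mx (real_complex R) J) = 0.
  by rewrite det_map_mx d0 rmorph0.
have /h : eigenvalue (map_mx (real_complex R) J) 0.
  by apply/eigenvalueP; exists v; rewrite // scale0r.
by rewrite /= eqxx.
Qed.

Section Admissible.
Local Open Scope classical_set_scope.
Local Open Scope ring_scope.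
Variables (R : realType) (n : nat) (G : io_network n) (f : vector_field R n).
Hypothesis af : admissible G f.

Lemma admissible_pattern P p q : ~~ feeds G q p -> jacobian_x f P p q = 0.
Proof.
rewrite negb_or => /andP [pq Gqp]; rewrite mxE.
by apply: (adm_arrow af pq).2.
Qed.

Lemma admissible_partial_I P p : p != inp G -> partial_I f p P = 0.
Proof.
move=> pi; apply: (@derive_quadratic _ _ _ _ _ _ 0) => h.
rewrite !mulr0 !addr0; case: P => X I.
rewrite -[_ + _]/(h *: 0 + X, h *: 1 + I) scaler0 add0r.
exact: (adm_param af).
Qed.

Lemma admissible_differentiable p P : differentiable (f p) P.
Proof. exact: (adm_smooth af p [::]). Qed.

(** The chain rule for [f p (X I, I) = 0]. *)
Lemma equilibrium_family_derivative X0 I0 X p :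
  equilibrium_family f X0 I0 X ->
  \sum_q jacobian_x f (X0, I0) p q * derive1 (fun I => X I 0 q) I0 +
    partial_I f p (X0, I0) = 0.
Proof.
case=> XI0 nearX; have [dX _] := nbhs_singleton nearX.
have diffX : differentiable X I0 by apply/derivable1_diffP.
have did : differentiable (id : R -> R) I0 by [].
pose h (y : R) := (X y, y).
have dh : differentiable h I0 := differentiable_pair diffX did.
have hI0 : h I0 = (X0, I0) by rewrite /h XI0.
have dfh : 'D_1 (f p \o h) I0 = 0.
  rewrite (@near_eq_derive _ _ _ _ (cst 0)).
    by rewrite derive_cst.
  near=> I; rewrite /= /h; have [_] : derivable X I 1 /\ forall j, f j (X I, I) = 0.
    by near: I.
  by apply.
have dfp := admissible_differentiable p (h I0).
move: dfh; rewrite deriveE; last exact: differentiable_comp dh dfp.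
rewrite (diff_comp dh dfp) /= (diff_pair diffX did) hI0.
have -> : 'd X I0 1 = \row_q derive1 (fun I => X I 0 q) I0.
  rewrite -deriveE // derive_mx //; apply/rowP => q; rewrite !mxE.
  by rewrite derive1E.
have -> : 'd id I0 1 = (1 : R) by rewrite -deriveE // derive_id.
set y := \row_q _.
have -> : (y, 1) = \sum_q y 0 q *: ((delta_mx 0 q : 'rV[R]_n.+1), (0 : R)) +
    ((0 : 'rV[R]_n.+1), (1 : R)).
  have -> : \sum_q y 0 q *: ((delta_mx 0 q : 'rV[R]_n.+1), (0 : R)) = (y, 0).
    rewrite [y in RHS]row_sum_delta; elim/big_rec2: _ => // q x z _ ->.
    by congr pair; rewrite /= scaler0 addr0.
  by congr pair; rewrite /= ?addr0 ?add0r.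
rewrite linearD linear_sum /= => dfh; rewrite -[RHS]dfh.
have dfp0 := admissible_differentiable p (X0, I0).
congr (_ + _); last by rewrite /partial_I deriveE.
apply: eq_bigr => q _; rewrite linearZ /= mxE /partial_x deriveE // mulrC mxE.
by [].
Unshelve. all: by end_near. Qed.

End Admissible.

Section Sufficiency.
Variables (R : realType) (n : nat) (G : io_network n).
Hypothesis hcore : core G.
Variables (q : nat) (rho : q.+2.-tuple 'I_n.+1).
Hypothesis hrho : super_simple_order G rho.
Variable j : 'I_q.+1.
Local Notation r := (rho_after rho j).

Lemma respects_patternE (J : 'M[R]_n.+1) :
  respects_pattern G J <-> forall p q, ~~ feeds G q p -> J p q = 0.
Proof. by split=> h p l; have := h p l; rewrite jacobian_patternE. Qed.

Lemma structural_after_row (F : block_form n) (eta : 'I_(bf_size F)) :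
  is_homeostasis_form G F -> block_nodes G eta = structural_subnetwork G rho j ->
  r \in block_rows G eta /\ r \notin block_cols G eta.
Proof.
by move=> hF bn; apply: (after_row_not_col hcore hrho hF); rewrite bn;
  [left; left | right].
Qed.

(** The genericity condition is that the determinant of [cut_matrix] be nonzero.  Row
[r] belongs to the block, so [cut_matrix_point] makes the block singular. *)
Lemma not_before_induced k : ~~ before G r k ->
  induces_node R G (structural_subnetwork G rho j) k.
Proof.
move=> nk; have [F [eta [hF bn]]] := structural_block_form hcore hrho j.
exists F, eta; split=> //.
have [rR _] := structural_after_row hF bn.
have ri := rho_after_neq_inp hcore hrho j.
have ssr := rho_super hrho (lift ord0 j).
exists (\det (cut_matrix G r (\matrix_(a, b) entry_var R a b))); split.
  have [p ip] := io_path_exists hcore; have [s ms _] := path_matching ip.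
  have [J [Jpat Jr dJ]] := cut_matrix_point ri R ms ssr.
  exists J, 0; split; first exact/respects_patternE.
  - by apply: det_block_zero_row rR _.
  - by rewrite eval_det_cut_matrix.
move=> f X0 I0 af hyp db ev X eX; rewrite eval_det_cut_matrix in ev.
have dJ := det_neq0_spectrum hyp.2.
have Jpat := admissible_pattern af (X0, I0).
pose y l := derive1 (fun I => X I 0 l) I0.
have hy p : p != inp G -> \sum_l jacobian_x f (X0, I0) p l * y l = 0.
  move=> pi; have := equilibrium_family_derivative af p eX.
  by rewrite (admissible_partial_I af) // addr0.
have yo := singular_block_output hF Jpat dJ db hy.
exact: (cut_matrix_zero ri Jpat ssr hy yo ev nk).
Qed.

End Sufficiency.

(** * Genericity among matrices with a singular block *)

Lemma poly_nonroot (R : numDomainType) (q : {poly R}) : q != 0 ->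
  exists t, q.[t] != 0.
Proof.
move=> q0; apply: contrapT => h.
have hall t : root q t by apply/negPn/negP => nt; apply: h; exists t.
pose rs := [seq i%:R : R | i <- iota 0 (size q)].
have : (size rs < size q)%N.
  apply: max_poly_roots q0 _ _; first by apply/allP => t _.
  by rewrite map_inj_uniq ?iota_uniq // => a b /eqP; rewrite eqr_nat => /eqP.
by rewrite size_map size_iota ltnn.
Qed.

Section PolynomialFunctions.
Variables (R : realType) (N : nat).
Implicit Types (g : 'M[R]_N.+1 -> R -> R).

(** Being polynomial along polynomial curves is all that the perturbations below use,
and for determinants it follows from naturality in the ring of coefficients. *)
Definition polynomial_fun g : Prop :=
  forall (J : 'M[{poly R}]_N.+1) (c : {poly R}), exists q : {poly R}, forall t,
    q.[t] = g (map_mx (horner_eval t) J) c.[t].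

Lemma polynomial_fun_mul g1 g2 : polynomial_fun g1 -> polynomial_fun g2 ->
  polynomial_fun (fun J c => g1 J c * g2 J c).
Proof.
move=> h1 h2 J c; have [q1 e1] := h1 J c; have [q2 e2] := h2 J c.
by exists (q1 * q2) => t; rewrite hornerM e1 e2.
Qed.

Lemma polynomial_eval_partials (p : mpoly.mpoly (N.+1 * N.+1 + 1) R) :
  polynomial_fun (eval_partials p).
Proof.
move=> J c.
pose v i := row_mx (mxvec J) (c%:M : 'M[{poly R}]_1) 0 i.
exists (\sum_(m <- mpoly.msupp p)
  (mpoly.mcoeff m p)%:P * \prod_i v i ^+ (mpoly.fun_of_multinom m i)) => t.
rewrite /eval_partials mpoly.mevalE horner_sum; apply: eq_bigr => m _.
rewrite hornerM hornerC horner_prod; congr (_ * _); apply: eq_bigr => i _.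
rewrite horner_exp; congr (_ ^+ _).
have -> : row_mx (mxvec (map_mx (horner_eval t) J)) (c.[t])%:M =
    map_mx (horner_eval t) (row_mx (mxvec J) (c%:M : 'M[{poly R}]_1)).
  by rewrite map_row_mx map_mxvec map_scalar_mx.
by rewrite mxE.
Qed.

(** Up to sign the product of all sums of two eigenvalues: it vanishes exactly when
[J] has two opposite eigenvalues (or the eigenvalue zero), in particular when a
real [J] has an eigenvalue on the imaginary axis. *)
Definition opposite_spectrum (K : comNzRingType) (J : 'M[K]_N.+1) : K :=
  \det (horner_mx (- J) (char_poly J)).

Lemma opposite_spectrum_map (K L : comNzRingType) (h : {rmorphism K -> L})
    (J : 'M[K]_N.+1) :
  opposite_spectrum (map_mx h J) = h (opposite_spectrum J).
Proof.
rewrite /opposite_spectrum -(det_map_mx h); congr (\det _).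
by rewrite -map_char_poly -map_mxN; apply/esym/(map_horner_mx h).
Qed.

Lemma polynomial_opposite_spectrum :
  polynomial_fun (fun J _ => opposite_spectrum J).
Proof.
by move=> J c; exists (opposite_spectrum J) => t; rewrite opposite_spectrum_map.
Qed.

Lemma horner_mx_scalar (K : comNzRingType) (a : K) p :
  horner_mx (a%:M : 'M[K]_N.+1) p = (p.[a])%:M.
Proof.
elim/poly_ind: p => [|p c IH]; first by rewrite rmorph0 horner0 raddf0.
rewrite rmorphD rmorphM /= horner_mx_X horner_mx_C IH -mulmxE -scalar_mxM.
by rewrite -raddfD !hornerE.
Qed.

Lemma opposite_spectrum1 : opposite_spectrum (1%:M : 'M[R]_N.+1) != 0.
Proof.
rewrite /opposite_spectrum (_ : - 1%:M = (-1)%:M); last by rewrite raddfN.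
rewrite horner_mx_scalar det_scalar expf_neq0 //.
rewrite char_poly_trig ?scalar_mx_is_trig // horner_prod.
apply/prodf_neq0 => i _; rewrite mxE eqxx !hornerE.
by rewrite -opprD oppr_eq0 (_ : 1 + 1 = 2%:R) // pnatr_eq0.
Qed.

Lemma eigenvector_horner (K : fieldType) (A : 'M[K]_N.+1) (v : 'rV[K]_N.+1) a p :
  v *m A = a *: v -> v *m horner_mx A p = p.[a] *: v.
Proof.
move=> vA; elim/poly_ind: p => [|p c IH].
  by rewrite rmorph0 mulmx0 horner0 scale0r.
rewrite rmorphD rmorphM /= horner_mx_X horner_mx_C mulmxDr -mulmxE mulmxA IH.
by rewrite -scalemxAl vA scalerA mul_mx_scalar -scalerDl !hornerE.
Qed.

(** The conjugate of an imaginary eigenvalue of a real matrix is its opposite. *)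
Lemma opposite_spectrum_hyperbolic (J : 'M[R]_N.+1) (z : R[i]) :
  opposite_spectrum J != 0 -> eigenvalue (map_mx (real_complex R) J) z ->
  complex.Re z != 0.
Proof.
move=> sJ ez; apply: contraNneq sJ => z0.
rewrite -(fmorph_eq0 (real_complex R)) -opposite_spectrum_map.
set A := map_mx _ J in ez *.
have [v vA v0] := eigenvalueP ez.
apply/det0P; exists v => //.
rewrite (eigenvector_horner (a := - z)); last by rewrite mulmxN vA scaleNr.
have -> : - z = conjc z.
  by case: z z0 {ez vA} => x y /= ->; rewrite /GRing.opp /= oppr0.
have rz : root (char_poly A) z by rewrite -eigenvalue_root_char.
have cA : map_poly (@conjc R) (char_poly A) = char_poly A.
  rewrite /A -map_char_poly -map_poly_comp; apply: eq_map_poly => x.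
  by rewrite /= oppr0.
by rewrite -cA horner_map /= (eqP rz) conjc0 scale0r.
Qed.

End PolynomialFunctions.

Section SingularMatrices.
Variables (R : realType) (N : nat).
Local Notation node := 'I_N.+1.
Variables (pattern : rel node) (rows cols : {set node}).
Implicit Types (J : 'M[R]_N.+1) (w : node -> R) (p q : node) (Z : {set node}).

Definition annihilates J w : Prop :=
  forall p, p \in rows -> \sum_(q in cols) J p q * w q = 0.

Definition has_pattern J : Prop := forall p q, ~~ pattern p q -> J p q = 0.

Definition confined Z : {set node} :=
  [set p in rows | [forall q in cols :\: Z, ~~ pattern p q]]%SET.

(** Fewer equations than unknowns. *)
Lemma small_kernel J (P Z : {set node}) : (#|P| < #|Z|)%N ->
  exists u : node -> R, [/\ exists2 q, q \in Z & u q != 0,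
    forall q, q \notin Z -> u q = 0 &
    forall p, p \in P -> \sum_(q in Z) J p q * u q = 0].
Proof.
move=> PZ.
pose M : 'M[R]_(#|Z|, #|P|) := \matrix_(i, k) J (enum_val k) (enum_val i).
have kM : kermx M != 0.
  rewrite -mxrank_eq0 mxrank_ker subn_eq0 -ltnNge.
  exact: leq_ltn_trans (rank_leq_col M) PZ.
have /rowV0Pn [v /sub_kermxP vM v0] := kM.
pose u q := \sum_(i < #|Z| | enum_val i == q) v 0 i.
have uE i : u (enum_val i) = v 0 i.
  rewrite /u (bigD1 i) //= big1 ?addr0 // => i' /andP [/eqP e].
  by rewrite (enum_val_inj e) eqxx.
exists u; split.
- have /existsP [i vi] : [exists i, v 0 i != 0].
    rewrite -negb_forall; apply: contraNN v0 => /forallP h; apply/eqP/rowP => i.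
    by rewrite mxE; apply/eqP.
  by exists (enum_val i); rewrite ?uE // enum_valP.
- move=> q qZ; rewrite /u big1 // => i /eqP e.
  by move: qZ; rewrite -e enum_valP.
- move=> p pP; move/rowP: vM => /(_ (enum_rank_in pP p)); rewrite !mxE => e.
  rewrite (big_enum_val (fun q => J p q * u q)) -[RHS]e.
  by apply: eq_bigr => i _; rewrite uE !mxE enum_rankK_in // mulrC.
Qed.

Hypothesis Hall : forall Z, (Z \subset cols)%SET -> Z != finset.set0 ->
  Z != cols -> (#|confined Z| < #|Z|)%N.

(** Let [Z] be the set of zeros of [w].  By Hall's condition there is a nonzero [u]
supported on [Z] which solves the equations of the rows confined to [Z].  In every
other row some entry faces a nonzero coordinate of [w] outside [Z], and changing
that entry linearly in [t] keeps the equation satisfied by [w + t u]; for generic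
[t] this vector has fewer zeros, and [g] does not vanish. *)
Lemma full_support_dense g J w c : polynomial_fun g -> has_pattern J ->
  annihilates J w -> (exists2 q, q \in cols & w q != 0) -> g J c != 0 ->
  exists J' w', [/\ has_pattern J', annihilates J' w',
    forall q, q \in cols -> w' q != 0 & g J' c != 0].
Proof.
move=> pg.
have [m] := ubnP #|[set q in cols | w q == 0]%SET|.
elim: m J w => // m IH J w; set Z := [set q in cols | w q == 0]%SET.
move=> Zm Jpat Jw [q0 q0C wq0] gJ.
have ZC : (Z \subset cols)%SET by apply/fintype.subsetP => q; rewrite inE => /andP [].
have inZ q : q \in cols -> (q \in Z) = (w q == 0) by move=> qC; rewrite inE qC.
have [Z0|Z0] := eqVneq Z finset.set0.
  exists J, w; split=> // q qC; by rewrite -inZ // Z0 inE.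
have ZneC : Z != cols.
  by apply: contraNneq wq0 => e; rewrite -inZ // e.
have [u [[q1 q1Z uq1] u0 hu]] := small_kernel J (Hall ZC Z0 ZneC).
pose ch p := odflt p [pick q in cols :\: Z | pattern p q].
have chP p : p \in rows -> p \notin confined Z ->
    [/\ ch p \in cols, w (ch p) != 0, u (ch p) = 0 & pattern p (ch p)].
  move=> pR; rewrite inE pR /= => /forallPn [q].
  rewrite negb_imply negbK => /andP [qD pq]; rewrite /ch; case: pickP => [q' /=|].
    rewrite inE => /andP [/andP [nZ qC] pq']; split=> //; first by rewrite -inZ.
    exact: u0.
  by move=> /(_ q); rewrite /= qD pq.
pose S p := \sum_(q in cols) J p q * u q.
have SE p : S p = \sum_(q in Z) J p q * u q.
  rewrite /S (bigID (mem Z)) /= [X in _ + X]big1 ?addr0; last first.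
    by move=> q /andP [_ /u0 ->]; rewrite mulr0.
  apply: eq_bigl => q; case: (boolP (q \in Z)) => qZ; last by rewrite andbF.
  by rewrite (fintype.subsetP ZC).
pose E p q := if [&& p \in rows, p \notin confined Z & q == ch p]
  then - (S p / w (ch p)) else 0.
pose Jt t : 'M[R]_N.+1 := \matrix_(p, q) (J p q + t * E p q).
pose wt t q := w q + t * u q.
have Jtpat t : has_pattern (Jt t).
  move=> p q npq; rewrite mxE Jpat // add0r /E; case: ifP => [|_]; last by rewrite mulr0.
  case/and3P => pR pc /eqP qE; have [_ _ _] := chP p pR pc.
  by rewrite -qE (negPf npq).
have Jtw t : annihilates (Jt t) (wt t).
  move=> p pR.
  have -> : \sum_(q in cols) Jt t p q * wt t q = \sum_(q in cols) J p q * w q +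
      (t * S p + t * \sum_(q in cols) E p q * wt t q).
    rewrite /S !mulr_sumr -!big_split /=.
    by apply: eq_bigr => q _; rewrite mxE /wt; ring.
  rewrite Jw // add0r.
  have [pc|pc] := boolP (p \in confined Z).
    rewrite SE hu // mulr0 add0r big1 ?mulr0 // => q _.
    by rewrite /E pc andbF mul0r.
  have [cC wc uc _] := chP p pR pc.
  rewrite (bigD1 (ch p)) //= big1 ?addr0; last first.
    by move=> q /andP [_ qc]; rewrite /E (negPf qc) !andbF mul0r.
  rewrite /E pR pc eqxx /= /wt uc mulr0 addr0 mulNr mulrVK ?unitfE //.
  by rewrite mulrN subrr.
pose JP : 'M[{poly R}]_N.+1 := \matrix_(p, q) ((J p q)%:P + 'X * (E p q)%:P).
have [Q QE] := pg JP c%:P.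
have JPE t : map_mx (horner_eval t) JP = Jt t.
  by apply/matrixP => p q; rewrite !mxE /= /horner_eval !hornerE.
have Q0 : Q * 'X != 0.
  rewrite mulf_neq0 ?polyX_eq0 //; apply: contraNneq gJ => Q0.
  have := QE 0; rewrite Q0 horner0 JPE hornerC => e.
  rewrite [X in g X](_ : J = Jt 0) -?e //.
  by apply/matrixP => p q; rewrite mxE mul0r addr0.
have [t] := poly_nonroot Q0; rewrite hornerMX mulf_eq0 negb_or => /andP [Qt t0].
apply: (IH (Jt t) (wt t)) => //.
- rewrite ltnS in Zm; apply: leq_trans Zm; apply: proper_card.
  apply/properP; split.
    apply/fintype.subsetP => q; rewrite inE => /andP [qC]; apply: contraTT => qZ.
    by rewrite /wt u0 // mulr0 addr0 -inZ.
  exists q1 => //; rewrite inE negb_and /wt; apply/orP; right.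
  move: (q1Z); rewrite inE => /andP [_ /eqP ->].
  by rewrite add0r mulf_neq0.
- by exists q0 => //; rewrite /wt u0 ?mulr0 ?addr0 // inZ.
- by rewrite -JPE -[c](hornerC c t) -QE.
Qed.

Variable partner : node -> node.
Hypothesis partnerP : forall p, p \in rows -> partner p \in cols /\ pattern p (partner p).

(** Matrices annihilating a vector [w] without zero entries are parametrized by [w]
and by the entries outside one chosen position [partner p] in each row [p].
Interpolating linearly between the parameters, after multiplying row [p] by the
coordinate of [w] at [partner p] to clear denominators, gives a polynomial curve
between any two of them. *)
Lemma full_support_connected g1 g2 J1 w1 c1 J2 w2 c2 :
  polynomial_fun g1 -> polynomial_fun g2 ->
  has_pattern J1 -> annihilates J1 w1 -> (forall q, q \in cols -> w1 q != 0) ->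
  g1 J1 c1 != 0 ->
  has_pattern J2 -> annihilates J2 w2 -> (forall q, q \in cols -> w2 q != 0) ->
  g2 J2 c2 != 0 ->
  exists J w c, [/\ has_pattern J, annihilates J w,
    forall q, q \in cols -> w q != 0, g1 J c != 0 & g2 J c != 0].
Proof.
move=> pg1 pg2 P1 A1 W1 h1 P2 A2 W2 h2.
pose seg (a b : R) : {poly R} := a%:P + 'X * (b - a)%:P.
have seg0 a b : (seg a b).[0] = a.
  by rewrite /seg hornerD hornerM !hornerC hornerX mul0r addr0.
have seg1 a b : (seg a b).[1] = b.
  by rewrite /seg hornerD hornerM !hornerC hornerX mul1r addrC subrK.
pose W q := seg (w1 q) (w2 q).
pose L p q := seg (J1 p q / w1 (partner p)) (J2 p q / w2 (partner p)).
pose JP : 'M[{poly R}]_N.+1 := \matrix_(p, q)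
  if (p \in rows) && (q \in cols) then
    if q == partner p then - \sum_(q' in cols | q' != partner p) L p q' * W q'
    else W (partner p) * L p q
  else seg (J1 p q) (J2 p q).
pose Jt t := map_mx (horner_eval t) JP.
pose wt t q := (W q).[t].
have Jtpat t : has_pattern (Jt t).
  move=> p q npq; rewrite !mxE /= /horner_eval.
  have s0 : seg 0 0 = 0 by rewrite /seg subrr mulr0 addr0.
  case: ifP => [/andP [pR qC]|_]; last by rewrite P1 // P2 // s0 horner0.
  case: eqVneq => [e|_].
    by have [_] := partnerP pR; rewrite -e (negPf npq).
  by rewrite /L P1 // P2 // !mul0r s0 mulr0 horner0.
have Jtw t : annihilates (Jt t) (wt t).
  move=> p pR; have [cC _] := partnerP pR.
  rewrite (bigD1 (partner p)) //= !mxE /= pR cC eqxx /horner_eval hornerN horner_sum.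
  rewrite mulNr mulr_suml addrC; apply/eqP; rewrite subr_eq0; apply/eqP.
  apply: eq_bigr => q /andP [qC qc]; rewrite !mxE /= pR qC (negPf qc) /horner_eval.
  by rewrite !hornerM /wt; ring.
(* each end of the curve is the given matrix: the annihilation of [w] determines
   the entry at [partner p] from the others *)
have ends J w t : annihilates J w -> (forall q, q \in cols -> w q != 0) ->
    (forall p q, (L p q).[t] = J p q / w (partner p)) ->
    (forall q, (W q).[t] = w q) ->
    (forall p q, (seg (J1 p q) (J2 p q)).[t] = J p q) -> Jt t = J.
  move=> A Wn LE WE sE; apply/matrixP => p q; rewrite !mxE /= /horner_eval.
  case: ifP => [/andP [pR qC]|_]; last exact: sE.
  have [cC _] := partnerP pR; have cn := Wn _ cC.
  case: eqVneq => [->|qc]; last by rewrite hornerM LE WE mulrC divfK.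
  rewrite hornerN horner_sum; have := A p pR; rewrite (bigD1 (partner p)) //=.
  move/eqP; rewrite addr_eq0 => /eqP e.
  have -> : \sum_(q' in cols | q' != partner p) (L p q' * W q').[t] =
     (w (partner p))^-1 * \sum_(q' in cols | q' != partner p) J p q' * w q'.
    rewrite mulr_sumr; apply: eq_bigr => q' _; rewrite hornerM LE WE.
    by rewrite mulrAC mulrC.
  by rewrite -mulrN -e mulrC mulfK.
have J0 : Jt 0 = J1 by apply: (ends _ w1) => // *; apply: seg0.
have J1' : Jt 1 = J2 by apply: (ends _ w2) => // *; apply: seg1.
have [Q1 Q1E] := pg1 JP (seg c1 c2); have [Q2 Q2E] := pg2 JP (seg c1 c2).
pose Q := Q1 * Q2 * \prod_(q in cols) W q.
have nz (A : {poly R}) t : A.[t] != 0 -> A != 0.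
  by apply: contraNneq => ->; rewrite horner0.
have Qn : Q != 0.
  rewrite !mulf_neq0 //.
  - by apply: (@nz _ 0); rewrite Q1E -/(Jt 0) J0 seg0.
  - by apply: (@nz _ 1); rewrite Q2E -/(Jt 1) J1' seg1.
  - apply/prodf_neq0 => q qC; apply: (@nz _ 0); rewrite seg0; exact: W1.
have [t] := poly_nonroot Qn; rewrite !hornerM horner_prod !mulf_eq0 !negb_or.
case/andP => /andP [n1 n2] /prodf_neq0 nW.
exists (Jt t), (wt t), (seg c1 c2).[t].
split=> //.
- by rewrite /Jt -Q1E.
- by rewrite /Jt -Q2E.
Qed.

End SingularMatrices.

(** * Realizing a Jacobian and an infinitesimal response *)

Section PolynomialFields.
Variables (R : realType) (V : normedModType R).

(** A class of smooth functions that is visibly stable under directional derivatives;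
coordinates enter through the constancy of their derivatives. *)
Inductive polynomial_expr : (V -> R) -> Prop :=
| PolyConst (a : R) : polynomial_expr (cst a)
| PolyCoord (l : V -> R) : (forall x, differentiable l x) ->
    (forall v, exists a, forall x, 'D_v l x = a) -> polynomial_expr l
| PolyAdd f g : polynomial_expr f -> polynomial_expr g -> polynomial_expr (f \+ g)
| PolyMul f g : polynomial_expr f -> polynomial_expr g -> polynomial_expr (f \* g).

Lemma polynomial_expr_differentiable f x : polynomial_expr f -> differentiable f x.
Proof.
elim=> [a|l dl _|g h _ dg _ dh|g h _ dg _ dh] //.
- exact: differentiableD.
- exact: differentiableM.
Qed.

Lemma polynomial_expr_derive f v : polynomial_expr f ->
  polynomial_expr (fun x => 'D_v f x).
Proof.
elim=> [a|l dl cl|g h pg Dg ph Dh|g h pg Dg ph Dh].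
- rewrite (_ : (fun x => _) = cst 0); first exact: PolyConst.
  by apply/funext => x; rewrite derive_cst.
- have [a la] := cl v.
  rewrite (_ : (fun x => _) = cst a); first exact: PolyConst.
  by apply/funext => x; rewrite la.
- rewrite (_ : (fun x => _) = (fun x => 'D_v g x) \+ (fun x => 'D_v h x)).
    exact: PolyAdd.
  apply/funext => x.
  by apply: deriveD; apply/diff_derivable/polynomial_expr_differentiable.
- rewrite (_ : (fun x => _) =
      (g \* (fun x => 'D_v h x)) \+ (h \* (fun x => 'D_v g x))).
    by apply: PolyAdd; apply: PolyMul.
  apply/funext => x.
  by apply: deriveM; apply/diff_derivable/polynomial_expr_differentiable.
Qed.

Lemma polynomial_expr_smooth f : polynomial_expr f -> smooth f.
Proof.
move=> pf vs x; apply: polynomial_expr_differentiable.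
by elim: vs => //= v vs IH; apply: polynomial_expr_derive.
Qed.

Lemma polynomial_expr_sum (I : Type) (s : seq I) (F : I -> V -> R) :
  (forall i, polynomial_expr (F i)) -> polynomial_expr (fun x => \sum_(i <- s) F i x).
Proof.
move=> pF; elim: s => [|i s IH].
  rewrite (_ : (fun x => _) = cst 0); first exact: PolyConst.
  by apply/funext => x; rewrite big_nil.
rewrite (_ : (fun x => _) = F i \+ (fun x => \sum_(i <- s) F i x)).
  exact: PolyAdd.
by apply/funext => x; rewrite big_cons.
Qed.

End PolynomialFields.

Section Realization.
Variables (R : realType) (n : nat) (G : io_network n).
Local Notation node := 'I_n.+1.
Variables (J : 'M[R]_n.+1) (c : R) (y : node -> R).
Hypothesis Jpat : forall p q, ~~ feeds G q p -> J p q = 0.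
Let input (p : node) : R := if p == inp G then c else 0.
Hypothesis Jy : forall p, \sum_q J p q * y q + input p = 0.

(** The equilibrium is to move along the line spanned by [y].  Since a Jacobian entry
may be zero at the origin although its arrow is present, each arrow contributes a
quadratic term which vanishes on that line but whose derivative in the source
variable is not identically zero. *)
Let bend (p q : node) : R := if y q == 0 then 1 else - y p.

Let quad (p q : node) (X Y : 'rV[R]_n.+1) : R :=
  if (q != p) && G q p then bend p q * X 0 q * Y 0 q + y q * X 0 q * Y 0 p else 0.

Definition realizing_field : vector_field R n := fun p P =>
  \sum_q (J p q * P.1 0 q + quad p q P.1 P.1) + input p * P.2.

Lemma realizing_field_increment p (v P : 'rV[R]_n.+1 * R) (h : R) :
  realizing_field p (h *: v + P) = realizing_field p P +
    h * (\sum_q (J p q * v.1 0 q + (quad p q v.1 P.1 + quad p q P.1 v.1)) + input p * v.2)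
    + h ^+ 2 * \sum_q quad p q v.1 v.1.
Proof.
rewrite /realizing_field.
have -> : \sum_q (J p q * (h *: v + P).1 0 q + quad p q (h *: v + P).1 (h *: v + P).1) =
  \sum_q (J p q * P.1 0 q + quad p q P.1 P.1) +
  (h * (\sum_q (J p q * v.1 0 q + (quad p q v.1 P.1 + quad p q P.1 v.1)))
    + h ^+ 2 * \sum_q quad p q v.1 v.1).
  rewrite !mulr_sumr -!big_split /=; apply: eq_bigr => q _.
  rewrite /quad; case: ifP => _; rewrite !mxE; ring.
rewrite (_ : (h *: v + P).2 = h * v.2 + P.2) //; ring.
Qed.

Lemma partial_x_realizing_field p q P :
  partial_x realizing_field p q P = J p q + \sum_m
    (quad p m (delta_mx 0 q) P.1 + quad p m P.1 (delta_mx 0 q)).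
Proof.
rewrite /partial_x; apply: derive_quadratic => h; rewrite realizing_field_increment.
congr (_ + _ * _ + _); rewrite /= mulr0 addr0 big_split /=; congr (_ + _).
rewrite (bigD1 q) //= big1 ?addr0; first by rewrite !mxE !eqxx mulr1.
by move=> m mq; rewrite !mxE eqxx (negPf mq) mulr0.
Qed.

Lemma jacobian_realizing_field : jacobian_x realizing_field (0, 0) = J.
Proof.
apply/matrixP => p q; rewrite mxE partial_x_realizing_field big1 ?addr0 // => m _.
by rewrite /quad; case: ifP => _; rewrite ?mxE ?(mulr0, mul0r, addr0).
Qed.

Lemma partial_x_realizing_field_neq p q P : p != q ->
  partial_x realizing_field p q P = J p q +
    (if G q p then 2%:R * bend p q * P.1 0 q + y q * P.1 0 p else 0).
Proof.
move=> pq; rewrite partial_x_realizing_field; congr (_ + _).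
rewrite (bigD1 q) //= big1 ?addr0; last first.
  move=> m mq; rewrite /quad; case: ifP => _; rewrite ?addr0 // !mxE !eqxx.
  by rewrite (negPf mq) (negPf pq) !(mulr0, mul0r, addr0).
rewrite /quad eq_sym pq /=; case: ifP => _; last by rewrite addr0.
rewrite !mxE !eqxx (negPf pq) /=; ring.
Qed.

Lemma partial_I_realizing_field p P : partial_I realizing_field p P = input p.
Proof.
rewrite /partial_I; apply: derive_quadratic => h; rewrite realizing_field_increment.
congr (_ + _ * _ + _); rewrite /= mulr1 big1 ?add0r // => m _.
by rewrite /quad; case: ifP => _; rewrite ?mxE ?(mulr0, mul0r, addr0).
Qed.

(** For an arrow, the partial derivative is tested at the origin and at one of the
unit vectors of its two ends. *)
Lemma realizing_field_admissible : admissible G realizing_field.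
Proof.
have dfst (P : 'rV[R]_n.+1 * R) : differentiable (fst : 'rV[R]_n.+1 * R -> 'rV[R]_n.+1) P.
  by apply: linear_differentiable => x; exact: cvg_fst.
have dsnd (P : 'rV[R]_n.+1 * R) : differentiable (snd : 'rV[R]_n.+1 * R -> R) P.
  by apply: linear_differentiable => x; exact: cvg_snd.
have px q : polynomial_expr (fun P : 'rV[R]_n.+1 * R => P.1 0 q).
  apply: PolyCoord => [P|v].
    exact: differentiable_comp (dfst P) (differentiable_coord _ _ _).
  exists (v.1 0 q) => P; apply: (@derive_quadratic _ _ _ _ _ _ 0) => h.
  by rewrite /= !mxE mulr0 addr0 addrC.
have pI : polynomial_expr (fun P : 'rV[R]_n.+1 * R => P.2).
  apply: PolyCoord => // v; exists v.2 => P.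
  apply: (@derive_quadratic _ _ _ _ _ _ 0) => h.
  by rewrite /= mulr0 addr0 addrC.
split.
- move=> p; apply: polynomial_expr_smooth.
  have pquad q : polynomial_expr (fun P : 'rV[R]_n.+1 * R => quad p q P.1 P.1).
    rewrite /quad; case: (_ && _); last exact: PolyConst.
    apply: PolyAdd; first exact: (PolyMul (PolyMul (PolyConst _ _) (px q)) (px q)).
    exact: (PolyMul (PolyMul (PolyConst _ _) (px q)) (px p)).
  have plin q := PolyAdd (PolyMul (PolyConst _ (J p q)) (px q)) (pquad q).
  exact: PolyAdd (polynomial_expr_sum _ plin) (PolyMul (PolyConst _ _) pI).
- by move=> p X I I' pi; rewrite /realizing_field /input (negPf pi) !mul0r.
- move=> p X Y I XY; rewrite /realizing_field; congr (_ + _).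
  apply: eq_bigr => q _ /=; congr (_ + _).
    have [f|f] := boolP (feeds G q p); last by rewrite Jpat // !mul0r.
    by rewrite XY // eq_sym.
  rewrite /quad; case: ifP => // /andP [_ Gqp].
  by rewrite !XY ?eqxx // Gqp orbT.
- move=> p q pq; split=> [h|nG P]; last first.
    rewrite partial_x_realizing_field_neq // (negPf nG) addr0 Jpat //.
    by rewrite /feeds negb_or pq.
  apply/negP => Gqp.
  have h0 := h (0, 0).
  rewrite partial_x_realizing_field_neq // Gqp /= !mxE !mulr0 !addr0 in h0.
  have [yq|yq] := eqVneq (y q) 0.
    have := h (delta_mx 0 q, 0); rewrite partial_x_realizing_field_neq // Gqp h0 add0r.
    rewrite /= !mxE !eqxx yq mul0r addr0 /bend yq eqxx !mulr1 => /eqP.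
    by rewrite pnatr_eq0.
  have := h (delta_mx 0 p, 0); rewrite partial_x_realizing_field_neq // Gqp h0 add0r.
  rewrite /= !mxE !eqxx eq_sym (negPf pq) mulr0 add0r mulr1 => /eqP.
  by rewrite (negPf yq).
Qed.

Lemma realizing_field_equilibrium p (I : R) :
  realizing_field p (I *: (\row_q y q), I) = 0.
Proof.
rewrite /realizing_field big_split /= [X in _ + X + _]big1 ?addr0 => [|q _].
  transitivity (I * (\sum_q J p q * y q + input p)); last by rewrite Jy mulr0.
  rewrite mulrDr mulr_sumr [I * input p]mulrC; congr (_ + _).
  by apply: eq_bigr => q _; rewrite !mxE mulrCA.
rewrite /quad /bend; case: ifP => // _; rewrite !mxE.
by case: eqVneq => [->|_]; ring.
Qed.

Lemma realizing_field_family :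
  equilibrium_family realizing_field 0 0 (fun I => I *: (\row_q y q)).
Proof.
split; first by rewrite scale0r.
near=> I; split=> [|p]; last exact: realizing_field_equilibrium.
apply/derivable_mxP => a b.
rewrite (_ : (fun x => _) = (fun x => x * (\row_q y q) a b)); last first.
  by apply/funext => x; rewrite !mxE.
apply: derivableM; [exact: derivable_id|exact: derivable_cst].
Unshelve. all: by end_near. Qed.

Lemma realizing_field_not_homeostatic k : y k != 0 ->
  ~ homeostatic realizing_field 0 0 k.
Proof.
move=> yk /(_ _ realizing_field_family); rewrite derive1E => e.
case/eqP: yk; rewrite -e; apply/esym; apply: (@derive_quadratic _ _ _ _ _ _ 0) => h.
by rewrite /= !mxE mul0r mulr0 addr0 add0r addr0 [_ *: _]mulr1.
Qed.

Lemma realizing_field_hyperbolic :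
  (forall z, eigenvalue (map_mx (real_complex R) J) z -> complex.Re z != 0) ->
  hyperbolic_equilibrium realizing_field 0 0.
Proof.
move=> h; split; last by rewrite jacobian_realizing_field.
by move=> p; have := realizing_field_equilibrium p 0; rewrite scale0r.
Qed.

End Realization.

(** * Nodes before the cut respond generically *)

Section BlockSingularity.
Variables (R : realType) (n : nat) (G : io_network n) (F : block_form n).
Variable eta : 'I_(bf_size F).
Local Notation node := 'I_n.+1.

Lemma det_block_annihilates (J : 'M[R]_n.+1) : \det (block G eta J) = 0 <->
  exists2 w : node -> R, exists2 q, q \in block_cols G eta & w q != 0 &
    annihilates (block_rows G eta) (block_cols G eta) J w.
Proof.
have blockE : block G eta J =
    diagonal_block (block_interval eta) (permuted F (homeostasis_matrix G J)) by [].
have sumE (w : node -> R) p : \sum_(q in block_cols G eta) J p q * w q =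
    \sum_(b in block_interval eta) J p (col_node G F b) * w (col_node G F b).
  by rewrite big_imset //= => a b _ _; apply: col_node_inj.
rewrite blockE det_diagonal_block0P; split.
- case=> v [b bD vb] hv.
  pose w q := \sum_(b | col_node G F b == q) v b.
  have wE a : w (col_node G F a) = v a.
    rewrite /w (bigD1 a) //= big1 ?addr0 // => a' /andP [/eqP/col_node_inj ->].
    by rewrite eqxx.
  exists w; first by exists (col_node G F b); rewrite ?wE // imset_f.
  move=> p /imsetP [a aD ->]; rewrite sumE -[RHS](hv a aD).
  by apply: eq_bigr => b' _; rewrite wE permutedE.
- case=> w [_ /imsetP [b bD ->] wb] hw; exists (fun a => w (col_node G F a)).
    by exists b.
  move=> a aD; rewrite -[RHS](hw (row_node G F a)) ?imset_f // sumE.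
  by apply: eq_bigr => b' _; rewrite permutedE.
Qed.

End BlockSingularity.

Section RowReplacement.
Variables (n : nat) (G : io_network n) (k : 'I_n.+1).

(** By Cramer's rule its determinant is, up to a factor, the response of node [k] to
the input. *)
Definition input_row_replaced (K : pzRingType) (J : 'M[K]_n.+1) : 'M[K]_n.+1 :=
  \matrix_(a, b) if a == inp G then (b == k)%:R else J a b.

Lemma polynomial_input_row_replaced (R : realType) :
  polynomial_fun (fun (J : 'M[R]_n.+1) c => c * \det (input_row_replaced J)).
Proof.
move=> J c; exists (c * \det (input_row_replaced J)) => t.
rewrite hornerM; congr (_ * _).
rewrite -[LHS]/(horner_eval t _) -det_map_mx; congr (\det _).
by apply/matrixP => a b; rewrite !mxE; case: ifP => _; rewrite ?rmorph_nat.
Qed.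

(** The permutation matrix of the closed-up path from the input to [k]; its closing
entry is the one in the replaced row. *)
Lemma input_row_replaced_point (K : fieldType) p : simple_path G (inp G) k p ->
  exists J : 'M[K]_n.+1, [/\ forall a b, ~~ feeds G b a -> J a b = 0,
    forall a b, a \notin p -> b != a -> J a b = 0 &
    \det (input_row_replaced J) != 0].
Proof.
move=> ip; have [s sE sk] := path_perm ip.
exists (\matrix_(a, b) ((a == s b) && (b != k))%:R); split.
- move=> a b f; rewrite mxE; case: eqVneq => //= e; case: eqVneq => //= bk.
  case/negP: f; rewrite e sE; have [bp|bp] := boolP (b \in p).
    by rewrite /feeds (path_next ip) ?orbT.
  by rewrite next_notin // /feeds eqxx.
- move=> a b ap ba; rewrite mxE; case: eqVneq => //= e.
  have sa : s a = a by rewrite sE next_notin.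
  by move: ba; rewrite -(inj_eq (@perm_inj _ s)) -e sa eqxx.
- apply/eqP => /det0_kernel [w [b wb] hw]; case/negP: wb; apply/eqP.
  rewrite -[RHS](hw (s b)) (bigD1 b) //= big1 ?addr0.
    rewrite mxE -sk (inj_eq perm_inj); case: eqVneq => [->|bk].
      by rewrite ?eqxx mul1r.
    by rewrite mxE eqxx bk mul1r.
  move=> b' bb'; rewrite mxE -sk (inj_eq perm_inj); case: eqVneq => [e|bk].
    by rewrite -e (negPf bb') mul0r.
  by rewrite mxE (inj_eq perm_inj) eq_sym (negPf bb') mul0r.
Qed.

End RowReplacement.

Section Necessity.
Variables (R : realType) (n : nat) (G : io_network n).
Hypothesis hcore : core G.
Variables (q : nat) (rho : q.+2.-tuple 'I_n.+1).
Hypothesis hrho : super_simple_order G rho.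
Variable j : 'I_q.+1.
Local Notation r := (rho_after rho j).

(** The conditions to be met at a matrix with singular block are that [p] be nonzero,
that no two eigenvalues be opposite, and that [k] respond to the input.  They hold
separately: by hypothesis, at the identity, and at the matrix of a path to [k]
avoiding [r].  In the last two matrices row [r] vanishes in the columns of the
block. *)
Lemma before_not_induced k : before G r k ->
  ~ induces_node R G (structural_subnetwork G rho j) k.
Proof.
move=> bk [F [eta [hF bn [p [[J0 [c0 [P0 d0 p0]]] hp]]]]].
have [rR rC] := structural_after_row hcore hrho hF bn.
have [s ms _] : exists2 s, matching G s & True.
  have [t it] := io_path_exists hcore; have [s ms _] := path_matching it.
  by exists s.
set rows := block_rows G eta in rR; set cols := block_cols G eta in rC.
pose pat : rel 'I_n.+1 := fun a b => feeds G b a.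
have Hall Z := @block_Hall n G F hF eta Z.
have full (g : 'M[R]_n.+1 -> R -> R) J c : polynomial_fun g -> has_pattern pat J ->
    \det (block G eta J) = 0 -> g J c != 0 ->
    exists J' w', [/\ has_pattern pat J', annihilates rows cols J' w',
      forall x, x \in cols -> w' x != 0 & g J' c != 0].
  move=> pg PJ /det_block_annihilates [w w0 Jw] gJ.
  exact: (full_support_dense Hall pg PJ Jw w0 gJ).
pose partner a := (s^-1)%g a.
have partnerP a : a \in rows -> partner a \in cols /\ pat a (partner a).
  move=> aR; have uo : partner a != out G.
    rewrite -(matching_neq_inp _ ms) permKV.
    by case/imsetP: aR => b _ ->; apply: row_node_neq.
  rewrite -(block_matched hF _ ms uo) permKV; split=> //.
  by have := matching_feeds ms uo; rewrite permKV.
have [J1 [w1 [P1 A1 W1 g1]]] := full _ J0 c0 (polynomial_eval_partials p)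
  ((respects_patternE _ _).1 P0) d0 p0.
have P2 : has_pattern pat (1%:M : 'M[R]_n.+1).
  move=> a b; rewrite mxE /pat /feeds; case: eqVneq => //=.
have d2 : \det (block G eta (1%:M : 'M[R]_n.+1)) = 0.
  apply: (det_block_zero_row rR) => x xC; rewrite mxE.
  by case: eqVneq => // e; move: rC; rewrite e xC.
have [J2 [w2 [P2' A2 W2 g2]]] := full _ _ 0 (@polynomial_opposite_spectrum R n) P2 d2
  (opposite_spectrum1 R n).
have [ir _ ck] := and3P bk.
have [t it rt] := avoiding_simple_path ir ck.
have [J3 [P3 row3 g3]] := input_row_replaced_point R it.
have d3 : \det (block G eta J3) = 0.
  apply: (det_block_zero_row rR) => x xC; apply: row3 => //.
  by apply: contraNneq rC => <-.
have g3' : 1 * \det (input_row_replaced G k J3) != 0 by rewrite mul1r.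
have [J4 [w4 [P4 A4 W4 g4]]] :=
  full _ _ _ (@polynomial_input_row_replaced _ G k R) P3 d3 g3'.
have [J5 [w5 [c5 [P5 A5 W5 g5 g5']]]] := full_support_connected (c2 := 0) partnerP
  (polynomial_eval_partials p) (@polynomial_opposite_spectrum R n)
  P1 A1 W1 g1 P2' A2 W2 g2.
have [J [w [c [PJ AJ WJ gJ gJ']]]] := full_support_connected partnerP
  (polynomial_fun_mul (polynomial_eval_partials p) (@polynomial_opposite_spectrum R n))
  (@polynomial_input_row_replaced _ G k R) P5 A5 W5 (mulf_neq0 g5 g5') P4 A4 W4 g4.
move: gJ gJ'; rewrite !mulf_eq0 !negb_or => /andP [pJ sJ] /andP [c0' dk].
have spec := opposite_spectrum_hyperbolic sJ.
have dJ := det_neq0_spectrum spec.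
have Ju : J \in unitmx by rewrite unitmxE unitfE.
pose yv := - c *: (invmx J *m delta_mx (inp G) (0 : 'I_1)).
pose y x := yv x 0.
have Jy a : \sum_b J a b * y b + (if a == inp G then c else 0) = 0.
  have : J *m yv = - c *: delta_mx (inp G) 0 by rewrite -scalemxAr mulKVmx.
  move/colP => /(_ a); rewrite mxE => ->; rewrite !mxE eqxx andbT.
  by case: eqP => _; rewrite ?mulr1 ?mulr0 ?addNr ?addr0.
have yk : y k != 0.
  apply: contraNneq c0' => yk.
  have y0 b : y b = 0.
    apply/eqP; apply: contraNT dk => yb; apply/eqP/det0_kernel.
    exists y; first by exists b.
    move=> a; have [ai|ai] := eqVneq a (inp G).
      rewrite (bigD1 k) //= big1 ?addr0; first by rewrite yk mulr0.
      by move=> b' bk'; rewrite mxE ai eqxx (negPf bk') mul0r.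
    have := Jy a; rewrite (negPf ai) addr0 => e; rewrite -[RHS]e.
    by apply: eq_bigr => b' _; rewrite mxE (negPf ai).
  have := Jy (inp G); rewrite eqxx big1 ?add0r => [-> //|b _].
  by rewrite y0 mulr0.
have af := realizing_field_admissible c y PJ.
have hyp := realizing_field_hyperbolic Jy spec.
apply: (realizing_field_not_homeostatic Jy yk); apply: hp af hyp _ _.
  rewrite jacobian_realizing_field; apply/det_block_annihilates; exists w => //.
  by exists (partner r); [case: (partnerP _ rR)|apply: WJ; case: (partnerP _ rR)].
by rewrite jacobian_realizing_field partial_I_realizing_field eqxx.
Qed.

End Necessity.

Theorem theorem2p18 (R : realType) (n : nat) (G : io_network n) (hcore : core G)
    (q : nat) (rho : q.+2.-tuple 'I_n.+1) (hrho : super_simple_order G rho)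
    (j : 'I_q.+1) (A : set 'I_n.+1) (hA : appendage_subnetwork G A) :
  backbone_induces R G rho j A <->
  exists2 V : structural_pattern_node q,
    is_Vmin G rho A V & strictly_downstream V (Backbone j).
Proof.
rewrite (Vmin_downstreamP hcore hrho j hA); split=> h k Ak.
  by apply/negP => /(before_not_induced (R := R) hcore hrho); apply; apply: h.
exact: not_before_induced (h k Ak).
Qed.
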